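(* Let $(J,\gamma)$ be a real metrised nilpotent Jordan algebra of dimension $n$ such that $|\det\gamma|=1$. Let $\mathcal Y\subset J$ be the connected component of $\mathbf 0$ in the set of elements $a \in J$ such that $-a$ is quasi-regular, let $\mathcal D=\mathcal Y\times\mathbb R$, and let $\Delta$ be the involutive distribution on $\mathcal D$ given by the kernel of the $1$-form $\zeta(u,\mu)=\gamma(u,(-x)^{(-1)})-\mu$ at $(x,\alpha)\in\mathcal D$, $(u,\mu)\in J\times\mathbb R$. Let $M$ be the maximal integral manifold of $\Delta$ through $(\mathbf 0,0)\in\mathcal D$, equipped with the transversal vector field $\xi=(\mathbf 0,1)$. Then $M$ is a graph immersion with representing function given by the polynomial $$F(x)=\sum_{k=2}^{\infty}\frac{(-1)^k}{k}\gamma(x,x^{k-1}).$$ It is a non-degenerate, affine complete, Euclidean complete, homogeneous, symmetric improper affine hypersphere with parallel cubic form.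
   Context: Jordan algebras. A real Jordan algebra is a finite-dimensional real vector space with a commutative bilinear product $\bullet$ satisfying $x\bullet(x^2\bullet y)=x^2\bullet(x\bullet y)$; powers are $x^1=x$, $x^{k+1}=x\bullet x^k$; $L_x$ denotes multiplication by $x$. A trace form is a symmetric bilinear form $\gamma$ with $\gamma(u\bullet v,w)=\gamma(u,v\bullet w)$; $(J,\gamma)$ is metrised if $\gamma$ is a non-degenerate trace form on $J$. $J$ is nilpotent if for some $m$ every product of $m$ elements is zero. Linear coordinates $J\cong\mathbb R^n$ are fixed, and $\det\gamma$ is the determinant of the matrix of $\gamma$ in them. The unital hull $\hat J$ is $\mathbb R\times J$ with product $(\alpha,u)\hat\bullet(\beta,v)=(\alpha\beta,\alpha v+\beta u+u\bullet v)$ and unit $\hat e=(1,\mathbf 0)$. In a unital Jordan algebra with unit $e$, $y$ is the inverse of $x$ if $x\bullet y=e$ and $L_x,L_y$ commute. An element $a\in J$ is quasi-regular if $(1,-a)$ is invertible in $\hat J$; then $(1,-a)^{-1}=(1,-b)$ for a unique $b=:a^{(-1)}\in J$, the quasi-inverse of $a$. Graph immersions. A graph immersion is a smooth hypersurface immersion $f$ of an $n$-manifold into affine $(n+1)$-space equipped with a constant transversal vector field $\xi$. With $D$ the ambient flat connection, $D_X f_*Y=f_*(\nabla_XY)+h(X,Y)\xi$ defines the induced connection $\nabla$ and the affine fundamental form $h$; it is non-degenerate if $h$ is. Then $\hat\nabla$ is the Levi-Civita connection of the affine metric $h$ and $C=\nabla h$. ''Parallel cubic form'' means $\hat\nabla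 C=0$. ''Representing function $F$'' means that the immersion is $x\mapsto(x,F(x))$ with $\xi=(\mathbf 0,1)$. Such a graph is an improper affine hypersphere with affine normal $\xi$ if and only if $\det F''\equiv\pm1$ (same constant). ''Affine complete'': $h$ is (geodesically) complete. ''Euclidean complete'': complete for the metric induced from a Euclidean metric on the ambient space. ''Homogeneous'': a group of affine transformations of the ambient space acts on $M$ transitively and by isometries of $h$. ''Symmetric'': around each point there is an isometry of $h$ fixing it with differential $-\mathrm{Id}$. *)

(* Defs.v *)
From HB Require Import structures.
From mathcomp Require Import all_boot all_order all_algebra.
From mathcomp Require Import all_classical all_reals all_analysis.
From mathcomp Require mpoly.

Set Implicit Arguments.
Unset Strict Implicit.
Unset Printing Implicit Defensive.

Import Order.TTheory GRing.Theory Num.Theory.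
Import numFieldNormedType.Exports.

Local Open Scope classical_set_scope.
Local Open Scope ring_scope.

(** * Metrised nilpotent Jordan algebras

    The linear coordinates J = R^n being fixed, a Jordan algebra is a product on
    row vectors. *)

Section Jordan.
Context {R : realType} {n : nat}.
Implicit Types (mul : 'rV[R]_n -> 'rV[R]_n -> 'rV[R]_n).
Implicit Types (gamma : 'rV[R]_n -> 'rV[R]_n -> R).

Definition jordan_algebra mul : Prop :=
  [/\ bilinear_for *:%R *:%R mul, commutative mul &
      forall x y, mul x (mul (mul x x) y) = mul (mul x x) (mul x y)].

(** [jordan_word mul m x]: x is a product of m elements, bracketed in any way. *)
Inductive jordan_word mul : nat -> 'rV[R]_n -> Prop :=
| jordan_letter x : jordan_word mul 1 x
| jordan_bracket i j x y :
    jordan_word mul i x -> jordan_word mul j y ->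
    jordan_word mul (i + j) (mul x y).

(** There is no [jordan_word] of length 0, hence the requirement [0 < m]. *)
Definition nilpotent_algebra mul : Prop :=
  exists2 m, (0 < m)%N & forall x, jordan_word mul m x -> x = 0.

Definition trace_form mul gamma : Prop :=
  [/\ bilinear_for *%R *%R gamma, (forall u v, gamma u v = gamma v u) &
      forall u v w, gamma (mul u v) w = gamma u (mul v w)].

Definition nondegenerate_form (b : 'rV[R]_n -> 'rV[R]_n -> R) : Prop :=
  forall u, (forall v, b u v = 0) -> u = 0.

Definition metrised_algebra mul gamma : Prop :=
  trace_form mul gamma /\ nondegenerate_form gamma.

Definition form_matrix gamma : 'M[R]_n :=
  \matrix_(i, j) gamma (delta_mx 0 i) (delta_mx 0 j).

(** x^k for k >= 1 (with the junk value x for k = 0). *)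
Definition jordan_power mul (x : 'rV[R]_n) (k : nat) : 'rV[R]_n :=
  iter k.-1 (mul x) x.

Definition hull_mul mul (a b : R * 'rV[R]_n) : R * 'rV[R]_n :=
  (a.1 * b.1, a.1 *: b.2 + b.1 *: a.2 + mul a.2 b.2).

Definition hull_inverse mul (a b : R * 'rV[R]_n) : Prop :=
  hull_mul mul a b = (1, 0) /\
  forall z, hull_mul mul a (hull_mul mul b z) =
            hull_mul mul b (hull_mul mul a z).

Definition quasi_regular mul (a : 'rV[R]_n) : Prop :=
  exists c, hull_inverse mul (1, - a) c.

(** The quasi-inverse of a; 0 if a is not quasi-regular. *)
Definition quasi_inverse mul (a : 'rV[R]_n) : 'rV[R]_n :=
  xget 0 [set b | hull_inverse mul (1, - a) (1, - b)].

Definition jordan_Y mul : set 'rV[R]_n :=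
  connected_component [set a | quasi_regular mul (- a)] 0.

Definition jordan_D mul : set ('rV[R]_n * R) := [set p | jordan_Y mul p.1].

Definition jordan_zeta mul gamma (p w : 'rV[R]_n * R) : R :=
  gamma w.1 (quasi_inverse mul (- p.1)) - w.2.

Definition jordan_Delta mul gamma (p : 'rV[R]_n * R) : set ('rV[R]_n * R) :=
  [set w | jordan_zeta mul gamma p w = 0].

Definition jordan_F_term mul gamma (x : 'rV[R]_n) (k : nat) : R :=
  (-1) ^+ k / k%:R * gamma x (jordan_power mul x k.-1).

Definition jordan_F mul gamma (x : 'rV[R]_n) : R :=
  \big[+%R/0]_(2 <= k <oo) jordan_F_term mul gamma x k.

Definition polynomial_function (F : 'rV[R]_n -> R) : Prop :=
  exists p : mpoly.mpoly n R, forall x, F x = mpoly.meval (x 0) p.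

End Jordan.

(** * Smooth maps *)

(** f is C^k on the open set U. Since V is finite-dimensional in all uses, the
    derivative is C^k iff all its evaluations at fixed vectors are. *)
Fixpoint Ck_on {R : realType} {V W : normedModType R} (k : nat) (U : set V)
    (f : V -> W) : Prop :=
  match k with
  | 0%N => forall x, U x -> {for x, continuous f}
  | k'.+1 => (forall x, U x -> differentiable f x) /\
             forall v, Ck_on k' U (fun x => 'd f x v)
  end.

Definition smooth_on {R : realType} {V W : normedModType R} (U : set V)
    (f : V -> W) : Prop := forall k, Ck_on k U f.

(** * Integral manifolds of distributions on R^n x R *)

Section Distributions.
Context {R : realType} {n : nat}.
Implicit Types (D : set ('rV[R]_n * R)).
Implicit Types (Delta : 'rV[R]_n * R -> set ('rV[R]_n * R)).

Definition lie_bracket (X Y : 'rV[R]_n * R -> 'rV[R]_n * R) (p : 'rV[R]_n * R) :=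
  'd Y p (X p) - 'd X p (Y p).

Definition involutive_distribution D Delta : Prop :=
  forall (U : set ('rV[R]_n * R)) (X Y : 'rV[R]_n * R -> 'rV[R]_n * R),
    open U -> U `<=` D -> smooth_on U X -> smooth_on U Y ->
    (forall p, U p -> Delta p (X p)) -> (forall p, U p -> Delta p (Y p)) ->
    forall p, U p -> Delta p (lie_bracket X Y p).

(** A patch of an n-dimensional immersed submanifold: its parameter domain in R^n
    and its parametrisation. *)
Definition patch : Type := (set 'rV[R]_n * ('rV[R]_n -> 'rV[R]_n * R))%type.

Definition regular_patch (P : patch) : Prop :=
  [/\ open P.1, smooth_on P.1 P.2, set_inj P.1 P.2 &
      forall x, P.1 x -> injective ('d (P.2) x)].

(** The overlap of P and Q is open in the parameter domain of P, and the change of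
    parameters Q^-1 o P is smooth on it. *)
Definition smooth_transition (P Q : patch) : Prop :=
  let W := P.1 `&` P.2 @^-1` (Q.2 @` Q.1) in
  open W /\ exists2 tau : 'rV[R]_n -> 'rV[R]_n, smooth_on W tau &
    forall x, W x -> Q.1 (tau x) /\ Q.2 (tau x) = P.2 x.

(** A subset of R^n x R with a family of patches; the manifold topology is the one
    defined by the patches, not the subspace topology. *)
Record patched_set := PatchedSet {
  carrier : set ('rV[R]_n * R);
  patches : set patch }.

(** The last clause is second countability; the Hausdorff property holds
    automatically for subsets of R^n x R. *)
Definition immersed_submanifold (M : patched_set) : Prop :=
  [/\ forall P, patches M P -> regular_patch P /\ P.2 @` P.1 `<=` carrier M,
      forall P Q, patches M P -> patches M Q -> smooth_transition P Q &
      exists2 B : set patch, B `<=` patches M /\ countable B &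
        carrier M = \bigcup_(P in B) P.2 @` P.1].

Definition manifold_open (M : patched_set) (O : set ('rV[R]_n * R)) : Prop :=
  O `<=` carrier M /\ forall P, patches M P -> open (P.1 `&` P.2 @^-1` O).

Definition manifold_connected (M : patched_set) : Prop :=
  forall O, manifold_open M O -> manifold_open M (carrier M `\` O) ->
    O = set0 \/ O = carrier M.

Definition integral_manifold D Delta (M : patched_set) : Prop :=
  [/\ immersed_submanifold M, carrier M `<=` D &
      forall P x, patches M P -> P.1 x -> range ('d (P.2) x) = Delta (P.2 x)].

Definition connected_integral_manifold D Delta (p : 'rV[R]_n * R)
    (M : patched_set) : Prop :=
  [/\ integral_manifold D Delta M, manifold_connected M & carrier M p].

Definition smooth_inclusion (N M : patched_set) : Prop :=
  carrier N `<=` carrier M /\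
  forall P Q, patches N P -> patches M Q -> smooth_transition P Q.

Definition maximal_integral_manifold D Delta (p : 'rV[R]_n * R)
    (M : patched_set) : Prop :=
  connected_integral_manifold D Delta p M /\
  forall N, connected_integral_manifold D Delta p N -> smooth_inclusion N M.

(** f : R^n -> M is a diffeomorphism, that is, (R^n, f) is a patch of the maximal
    atlas of M and covers M. *)
Definition global_parametrisation (M : patched_set)
    (f : 'rV[R]_n -> 'rV[R]_n * R) : Prop :=
  [/\ regular_patch (setT, f), range f = carrier M &
      forall P, patches M P ->
        smooth_transition (setT, f) P /\ smooth_transition P (setT, f)].

End Distributions.

(** * Affine differential geometry of immersions f : R^n -> R^n x R

    Connections on R^n are given by their Christoffel symbols G:
    (nabla_X Y)(x) = (D_X Y)(x) + G x (X x) (Y x).  Tensor fields are evaluated on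
    constant vector fields. *)

Section AffineGeometry.
Context {R : realType} {n : nat}.
Implicit Types (f : 'rV[R]_n -> 'rV[R]_n * R) (xi : 'rV[R]_n * R).
Implicit Types (G : 'rV[R]_n -> 'rV[R]_n -> 'rV[R]_n -> 'rV[R]_n).
Implicit Types (h : 'rV[R]_n -> 'rV[R]_n -> 'rV[R]_n -> R).
Implicit Types (phi : 'rV[R]_n -> 'rV[R]_n).

Definition transversal_field f xi : Prop := forall x, ~ range ('d f x) xi.

Definition graph_map (F : 'rV[R]_n -> R) (x : 'rV[R]_n) : 'rV[R]_n * R :=
  (x, F x).

Definition connection G : Prop :=
  (forall x, bilinear_for *:%R *:%R (G x)) /\
  forall u v, smooth_on setT (fun x => G x u v).

Definition covariant_derivative G (X Y : 'rV[R]_n -> 'rV[R]_n) x :=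
  'D_(X x) Y x + G x (X x) (Y x).

(** D_X f_* Y = f_* (nabla_X Y) + h(X, Y) xi. *)
Definition gauss_formula f xi G h : Prop :=
  forall X Y : 'rV[R]_n -> 'rV[R]_n, smooth_on setT X -> smooth_on setT Y ->
  forall x, 'D_(X x) (fun y => 'd f y (Y y)) x =
    'd f x (covariant_derivative G X Y x) + h x (X x) (Y x) *: xi.

Definition induced_structure f xi G h : Prop :=
  connection G /\ gauss_formula f xi G h.

(** (nabla_u h)(v, w) *)
Definition covariant_derivative2 G h x u v w : R :=
  'D_u (fun y => h y v w) x - h x (G x u v) w - h x v (G x u w).

(** (nabla_s C)(u, v, w) *)
Definition covariant_derivative3 G
    (C : 'rV[R]_n -> 'rV[R]_n -> 'rV[R]_n -> 'rV[R]_n -> R) x s u v w : R :=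
  'D_s (fun y => C y u v w) x - C x (G x s u) v w - C x u (G x s v) w
    - C x u v (G x s w).

Definition non_degenerate h : Prop := forall x, nondegenerate_form (h x).

Definition levi_civita h G : Prop :=
  [/\ connection G, (forall x u v, G x u v = G x v u) &
      forall x u v w, covariant_derivative2 G h x u v w = 0].

(** [G] is the induced connection and [Gh] the Levi-Civita connection of h. *)
Definition parallel_cubic_form G h Gh : Prop :=
  forall x s u v w,
    covariant_derivative3 Gh (covariant_derivative2 G h) x s u v w = 0.

(** The transversal field xi is the affine normal: the volume form induced by xi
    agrees with the volume form of h up to sign. Since xi is constant, it is
    equiaffine with vanishing shape operator, so that the hypersphere is improper. *)
Definition improper_affine_hypersphere f xi h : Prop :=
  non_degenerate h /\
  forall x (X : 'I_n -> 'rV[R]_n),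
    `| \det (block_mx (\matrix_(i, j) ('d f x (X i)).1 0 j)
                      (\col_i ('d f x (X i)).2)
                      xi.1 (xi.2)%:M) | =
    Num.sqrt `| \det (\matrix_(i, j) h x (X i) (X j)) |.

Definition geodesic G (c : R -> 'rV[R]_n) : Prop :=
  forall t, [/\ derivable c t 1, derivable (derive1 c) t 1 &
    derive1 (derive1 c) t + G (c t) (derive1 c t) (derive1 c t) = 0].

Definition geodesically_complete G : Prop :=
  forall x u, exists c, [/\ geodesic G c, c 0 = x & derive1 c 0 = u].

Definition metric_isometry h phi : Prop :=
  exists psi : 'rV[R]_n -> 'rV[R]_n,
    [/\ cancel phi psi /\ cancel psi phi,
        smooth_on setT phi, smooth_on setT psi &
        forall x u v, h (phi x) ('d phi x u) ('d phi x v) = h x u v].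

Definition symmetric_space h : Prop :=
  forall x, exists phi,
    [/\ metric_isometry h phi, phi x = x & forall u, 'd phi x u = - u].

Definition affine_transformation (A : 'rV[R]_n * R -> 'rV[R]_n * R) : Prop :=
  bijective A /\
  exists (L : {linear ('rV[R]_n * R)%type -> ('rV[R]_n * R)%type}) b,
    forall p, A p = L p + b.

Definition affine_transformation_group
    (S : set ('rV[R]_n * R -> 'rV[R]_n * R)) : Prop :=
  [/\ forall A, S A -> affine_transformation A, S id,
      forall A B, S A -> S B -> S (A \o B) &
      forall A, S A -> exists2 B, S B & cancel A B /\ cancel B A].

Definition homogeneous f h : Prop :=
  exists S, [/\ affine_transformation_group S,
    forall A, S A -> exists2 phi, metric_isometry h phi & A \o f = f \o phi &
    forall p q, range f p -> range f q -> exists2 A, S A & A p = q].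

Definition euclidean_metric (g : 'rV[R]_n * R -> 'rV[R]_n * R -> R) : Prop :=
  [/\ bilinear_for *%R *%R g, (forall v w, g v w = g w v) &
      forall v, v != 0 -> 0 < g v v].

(** Length, for the metric induced by g, of the image under f of c on [0, 1]. *)
Definition curve_length g f (c : R -> 'rV[R]_n) : R :=
  \int[lebesgue_measure]_(t in `[0%R, 1%R])
    Num.sqrt (g (derive1 (f \o c) t) (derive1 (f \o c) t)).

Definition induced_distance g f (x y : 'rV[R]_n) : R :=
  inf [set curve_length g f c | c in
        [set c : R -> 'rV[R]_n | [/\ smooth_on setT c, c 0 = x & c 1 = y]]].

Definition euclidean_complete f : Prop :=
  forall g, euclidean_metric g ->
  forall s : nat -> 'rV[R]_n,
    (forall e, 0 < e -> exists N, forall i j, (N <= i)%N -> (N <= j)%N ->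
       induced_distance g f (s i) (s j) < e) ->
    exists x, induced_distance g f (s i) x @[i --> \oo] --> (0 : R).

End AffineGeometry.

(* Main.v *)
Require Import Defs.
From HB Require Import structures.
From mathcomp Require Import all_boot all_order all_algebra.
From mathcomp Require Import all_classical all_reals all_analysis.
From mathcomp Require Import ring lra.
From mathcomp Require mpoly.
Import Order.TTheory GRing.Theory Num.Theory.
Import numFieldNormedType.Exports.
Local Open Scope classical_set_scope.
Local Open Scope ring_scope.

Set Implicit Arguments.
Unset Strict Implicit.
Unset Printing Implicit Defensive.

(** The quasi-inverse of [- x] is [quasi x = x - x^2 + x^3 - ...], the unique
    solution of [q + x q = x], and associativity of [gamma] turns
    [gamma(u, quasi x)] into the derivative of the polynomial [F]. Hence the
    distribution is [dF = d alpha], whose leaves are the translates of the graph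
    of [F].

    The Hessian of [F] is [gamma(H_x u, v)] with
    [H_x = quasi'(x) = (1 + L_x)^-1 (1 - L_(quasi x))], unipotent and
    [gamma]-symmetric since [L_x] and [L_(quasi x)] commute; so its determinant is
    that of [gamma]. In the unital hull, inversion conjugates [exp L_y] into its
    inverse (both sides solve the same linear differential equation), which means
    that the affine map of [J] induced by [exp L_y] changes [F] by an affine
    function. These maps act transitively because [J] is nilpotent, so that
    parallelism, symmetry and geodesics need only be examined at [0], where
    everything is read off the product of [J]. The symmetry at [0] is
    [x |-> - quasi x], the geodesics through [0] are [exp (t u) - 1].

    Euclidean completeness holds for the graph of every smooth function: the
    induced distance dominates the Euclidean distance of the base points. *)

(** * Nilpotent Jordan algebras *)

(** Nilpotency enters as [L_x^m = 0], uniformly in [x]. It makes every series a finite sum, hence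
    polynomial in [x], and it makes [1 + L_x] injective: identities between quasi-inverses and their
    derivatives are verified after applying [1 + L_x], where the sums disappear.

    The step that carries the proof is [H_x (w + x w) = w - (quasi x) w], where [H_x] is the
    derivative of [quasi]. With [z = 1 + x] in the unital hull it reads [U_(1/z) L_z = L_(1/z)], [U]
    being the quadratic representation. It produces the differential equation behind the motions: if
    [x' = y + y x], that is [z' = y z], then the inverse of [z] satisfies the same equation with
    [- y] for [y].

    A motion acts on points by an affine map with linear part [E] and on all derivatives of [quasi]
    by the contragredient [E'], and [gamma] pairs [E] with [E']. Identities between derivatives of
    the potential are therefore transported from [0], where the second and third derivatives of
    [quasi] are sums of products. *)

Section NilpotentJordan.
Context {R : realType} {n : nat}.
Variable mul : {bilinear 'rV[R]_n -> 'rV[R]_n -> 'rV[R]_n}.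
Local Notation "x ** y" := (mul x y) (at level 40, left associativity).
Implicit Types (x y z u v w : 'rV[R]_n).

Hypothesis mulC : forall x y, x ** y = y ** x.
Hypothesis jordan : forall x y, x ** ((x ** x) ** y) = (x ** x) ** (x ** y).

(** Full polarisation of the Jordan identity. The defect [T a b c] is trilinear, symmetric in its
    last two arguments and zero on the diagonal, so its cyclic sum vanishes. *)
Lemma jordan_linearised x y z w :
  x ** ((y ** z) ** w) + y ** ((z ** x) ** w) + z ** ((x ** y) ** w) =
  (y ** z) ** (x ** w) + (z ** x) ** (y ** w) + (x ** y) ** (z ** w).
Proof.
pose T a b c := a ** ((b ** c) ** w) - (b ** c) ** (a ** w).
have TDl a a' b c : T (a + a') b c = T a b c + T a' b c.
  by rewrite /T linearDl (linearDl mul w) linearDr opprD addrACA.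
have TDm a b b' c : T a (b + b') c = T a b c + T a b' c.
  by rewrite /T linearDl !linearDl linearDr opprD addrACA.
have TDr a b c c' : T a b (c + c') = T a b c + T a b c'.
  by rewrite /T linearDr !linearDl linearDr opprD addrACA.
have TC a b c : T a b c = T a c b by rewrite /T (mulC b).
have Tx a : T a a a = 0 by rewrite /T jordan subrr.
have T2 a b : T a b b + T b a b *+ 2 = 0.
  (* The values at [a + b] and [a + 2 b] separate the terms of degree one in [b] from those of
     degree two. *)
  have := Tx (a + b); have := Tx (a + b + b); rewrite !(TDl, TDm, TDr) !Tx.
  rewrite !(TC b b a) => /rowP e1 /rowP e2; apply/rowP => i.
  move: (e1 i) (e2 i); rewrite !mxE; lra.
have : T x y z + T y z x + T z x y = 0.
  have := T2 x y; have := T2 x z; have := T2 x (y + z).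
  rewrite !(TDl, TDm, TDr) (TC x z y) (TC y z x).
  move=> /rowP e1 /rowP e2 /rowP e3; apply/rowP => i.
  move: (e1 i) (e2 i) (e3 i); rewrite !mxE; lra.
rewrite /T => /rowP e; apply/rowP => i; move: (e i); rewrite !mxE; lra.
Qed.

(* The linearised identity, read as an identity between operators on [z]. *)
Lemma mul_mulE x y w z : ((x ** y) ** w) ** z =
  (x ** w) ** (y ** z) + (y ** w) ** (x ** z) + (x ** y) ** (w ** z)
  - x ** (w ** (y ** z)) - y ** (w ** (x ** z)).
Proof.
have := jordan_linearised x y z w.
rewrite (mulC (y ** z) w) (mulC (z ** x) w) (mulC z ((x ** y) ** w)).
rewrite (mulC (y ** z) (x ** w)) (mulC (z ** x) (y ** w)) (mulC z x) (mulC z w).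
by move=> /rowP e; apply/rowP => i; move: (e i); rewrite !mxE; lra.
Qed.

(** * Powers and their multiplication operators *)

Definition commuting x y := forall w, x ** (y ** w) = y ** (x ** w).

(* [pow x k] is the power x^(k+1). *)
Definition pow x k := iter k (mul x) x.

(** By this recursion every [L_(x^k)] is a noncommutative polynomial in [L_x] and [L_(x^2)]; an
    operator that commutes with these two commutes with all of them. *)
Lemma powSS x k w : pow x k.+2 ** w =
  pow x k.+1 ** (x ** w) *+ 2 + pow x 1 ** (pow x k ** w)
  - pow x k ** (x ** (x ** w)) - x ** (x ** (pow x k ** w)).
Proof.
have -> : pow x k.+2 = (x ** pow x k) ** x by rewrite mulC.
rewrite mul_mulE (mulC (pow x k) x) -/(pow x 1) -/(pow x k.+1).
apply/rowP => i; rewrite !mxE -/(pow x 1); rewrite -[x ** pow x k]/(pow x k.+1).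
lra.
Qed.

Lemma commuting_pow x c : commuting c x -> commuting c (pow x 1) ->
  forall k, commuting c (pow x k).
Proof.
move=> cx cx2; elim/ltn_ind => -[|[|k]] IH w //.
have IH0 v : c ** (pow x k ** v) = pow x k ** (c ** v) by apply: IH.
have IH1 v : c ** (pow x k.+1 ** v) = pow x k.+1 ** (c ** v) by apply: IH.
rewrite !powSS !linearB linearD raddfMn /=.
by rewrite cx IH0 !cx IH0 cx2 IH0 IH1 !cx.
Qed.

Lemma commuting_powl x k : commuting x (pow x k).
Proof. by apply: commuting_pow => [w|w] //; exact: jordan. Qed.

(** Power associativity: the induction moves the outer factor [x] past [pow x j] by
    [commuting_powl]. *)
Lemma pow_mul x i j : pow x i ** pow x j = pow x (i + j).+1.
Proof.
elim: i => [|i IH] //=.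
by rewrite mulC -commuting_powl (mulC (pow x j)) IH.
Qed.

(** Turns nilpotency into the vanishing of a power of [L_x]; [k] multiplications make a word of
    [k.+1] letters. *)
Lemma word_iter k x v : jordan_word mul k.+1 (iter k (mul x) v).
Proof.
elim: k => [|k IH] /=; first exact: jordan_letter.
by rewrite -[k.+2]add1n; apply: jordan_bracket => //; exact: jordan_letter.
Qed.

(** * Resolvents and quasi-inverses *)

Variable m : nat.
Hypothesis mul_nil : forall x v, iter m (mul x) v = 0.

Lemma mul_nil_ge k x v : (m <= k)%N -> iter k (mul x) v = 0.
Proof. by move=> /subnK <-; rewrite addnC iterD mul_nil. Qed.

Lemma iter_mulD k x u v :
  iter k (mul x) (u + v) = iter k (mul x) u + iter k (mul x) v.
Proof. by elim: k => //= k ->; rewrite linearDr. Qed.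

Lemma iter_mulZ k x a v : iter k (mul x) (a *: v) = a *: iter k (mul x) v.
Proof. by elim: k => //= k ->; rewrite linearZr. Qed.

Lemma iter_mulZl k a x v : iter k (mul (a *: x)) v = a ^+ k *: iter k (mul x) v.
Proof.
by elim: k => [|k /= ->]; rewrite ?scale1r // linearZl linearZr /= scalerA exprS.
Qed.

(** The difference of the two vectors is fixed by [L_(- x)], whose [m]-th power is zero. This
    cancellation rule replaces computations with the geometric series. *)
Lemma one_plus_mul_inj x u v : u + x ** u = v + x ** v -> u = v.
Proof.
move=> uv; apply/eqP; rewrite -subr_eq0; set d := u - v.
have d1 : d = (- x) ** d.
  by rewrite linearNl /d linearBr /= opprB; apply/rowP => i; move/rowP: uv => /(_ i);
     rewrite !mxE; lra.
suff -> : d = iter m (mul (- x)) d by rewrite mul_nil.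
by elim: m => //= k <-.
Qed.

Definition resolvent x v := \sum_(k < m) (-1) ^+ k *: iter k (mul x) v.

Lemma resolventP x v : resolvent x v + x ** resolvent x v = v.
Proof.
rewrite /resolvent linear_sum -big_split /=.
under eq_bigr do rewrite linearZr /= -iterS.
transitivity (\sum_(0 <= k < m) ((-1) ^+ k *: iter k (mul x) v
    - (-1) ^+ k.+1 *: iter k.+1 (mul x) v)).
  by rewrite big_mkord; apply: eq_bigr => k _; rewrite exprS mulN1r scaleNr opprK.
rewrite (@telescope_sumr_eq _ 0 m (fun k => - ((-1) ^+ k *: iter k (mul x) v))) //; last first.
  by move=> k _; rewrite opprK addrC.
by rewrite mul_nil scaler0 oppr0 sub0r opprK expr0 scale1r.
Qed.

Definition quasi x := resolvent x x.

Lemma quasiP x : quasi x + x ** quasi x = x. Proof. exact: resolventP. Qed.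

Lemma quasiE x : quasi x = \sum_(k < m) (-1) ^+ k *: pow x k.
Proof. by []. Qed.

Lemma commuting_sum x (I : eqType) (r : seq I) (f : I -> 'rV[R]_n) :
  (forall i, commuting x (f i)) -> commuting x (\sum_(i <- r) f i).
Proof.
move=> fc w; rewrite !linear_sumlz linear_sumr.
by apply: eq_bigr => i _; exact: fc.
Qed.

Lemma commuting_quasi x : commuting x (quasi x).
Proof.
apply: commuting_sum => k w; rewrite !linearZl /= linearZr /=.
by rewrite -[iter k _ _]/(pow x k) commuting_powl.
Qed.

Lemma quasi_unique x v : v + x ** v = x -> v = quasi x.
Proof. by move=> vx; apply: (@one_plus_mul_inj x); rewrite quasiP. Qed.

(** [1 - quasi x] is the inverse of [1 + x] in the hull, so [x |-> - quasi x] is inversion seen in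
    J, hence an involution. *)
Lemma quasiK x : - quasi (- quasi x) = x.
Proof.
rewrite -(@quasi_unique (- quasi x) (- x)) ?opprK //.
by rewrite linearNl linearNr opprK /= mulC -[X in - X + _]quasiP opprD subrK.
Qed.

Lemma hull_inverse_quasi x : hull_inverse mul (1, x) (1, - quasi x).
Proof.
rewrite /hull_inverse /hull_mul /=; split.
  by rewrite mulr1 !scale1r linearNr -{2}(quasiP x) /=; congr (_, _); rewrite addKr subrr.
move=> [a u] /=; rewrite !mul1r !scale1r; congr (_, _).
rewrite !linearDr !linearNl !linearZr /= ?linearDr ?linearZr /= ?linearNr.
rewrite commuting_quasi (mulC (quasi x) x) scalerN.
by apply/rowP => i; rewrite !mxE; lra.
Qed.

Lemma quasi_regularT x : quasi_regular mul x.
Proof. by exists (1, - quasi (- x)); exact: hull_inverse_quasi. Qed.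

(** Injectivity of [1 + L_x] means that the product equation in the hull has one solution, so the
    element chosen by [xget] is known. *)
Lemma quasi_inverseE x : quasi_inverse mul (- x) = quasi x.
Proof.
rewrite /quasi_inverse opprK.
case: xgetP => [y _ [+ _]|/(_ (quasi x))]; last by case; exact: hull_inverse_quasi.
rewrite /hull_mul /= mulr1 !scale1r linearNr => -[/eqP].
by rewrite subr_eq0 => /eqP xy; apply: quasi_unique; rewrite -xy addNKr.
Qed.

(** The span of the powers of [x] of exponent at least [k + 1]. By power associativity these spans
    filter the subalgebra generated by [x]; the filtration vanishes at level [m] and measures the
    progress in [motion_transitive]. *)
Inductive power_ideal x k : 'rV[R]_n -> Prop :=
| power_ideal_pow i of (k <= i)%N : power_ideal x k (pow x i)
| power_ideal0 : power_ideal x k 0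
| power_idealD u v of power_ideal x k u & power_ideal x k v :
    power_ideal x k (u + v)
| power_idealZ a u of power_ideal x k u : power_ideal x k (a *: u).

Lemma power_ideal_sum x k (I : Type) (r : seq I) (f : I -> 'rV[R]_n) :
  (forall i, power_ideal x k (f i)) -> power_ideal x k (\sum_(i <- r) f i).
Proof.
by move=> fP; apply: big_ind => //; [exact: power_ideal0|exact: power_idealD].
Qed.

Lemma power_ideal_mul x j k u v : power_ideal x j u -> power_ideal x k v ->
  power_ideal x (j + k).+1 (u ** v).
Proof.
move=> uj; elim: uj v => {u} [i ji||u u' _ IH _ IH'|a u _ IH] v vk.
- elim: vk => {v} [i' ki||v v' _ IH _ IH'|a v _ IH].
  + by rewrite pow_mul; apply: power_ideal_pow; rewrite ltnS leq_add.
  + by rewrite linear0r; exact: power_ideal0.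
  + by rewrite linearDr; exact: power_idealD.
  + by rewrite linearZr; exact: power_idealZ.
- by rewrite linear0l; exact: power_ideal0.
- by rewrite linearDl; apply: power_idealD; auto.
- by rewrite linearZl; apply: power_idealZ; auto.
Qed.

Lemma power_ideal_le x j k u : (j <= k)%N -> power_ideal x k u -> power_ideal x j u.
Proof.
move=> jk; elim=> {u} [i ki||u v _ IH _ IH'|a u _ IH].
- by apply: power_ideal_pow; exact: leq_trans ki.
- exact: power_ideal0.
- exact: power_idealD.
- exact: power_idealZ.
Qed.

Lemma power_ideal_nil x u : power_ideal x m u -> u = 0.
Proof.
elim=> {u} [i mi||u v _ -> _ ->|a u _ ->]; rewrite ?addr0 ?scaler0 //.
exact: mul_nil_ge.
Qed.

End NilpotentJordan.

(* [det (1 + X N)] is invertible in R[X], hence constant. *)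
Lemma det_unipotent (R : realType) n (N : 'M[R]_n) m :
  iter m (fun A => A *m N) 1%:M = 0 -> \det (1%:M + N) = 1.
Proof.
move=> Nm; pose Np := map_mx polyC N; pose pw k := iter k (fun A => A *m N) 1%:M.
pose A := 1%:M + 'X *: Np.
(* The Neumann series for the inverse of [A], over [R[X]]. *)
pose B := \sum_(k < m) (- 'X) ^+ k *: map_mx polyC (pw k).
have BA : B *m A = 1%:M.
  rewrite /B /A mulmx_suml.
  transitivity (\sum_(0 <= k < m) ((- 'X) ^+ k *: map_mx polyC (pw k)
      - (- 'X) ^+ k.+1 *: map_mx polyC (pw k.+1))).
    rewrite big_mkord; apply: eq_bigr => k _.
    rewrite mulmxDr mulmx1 exprSr mulrN scaleNr opprK -scalemxAr -scalemxAl.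
    by rewrite -map_mxM scalerA mulrC.
  rewrite (@telescope_sumr_eq _ 0 m (fun k => - ((- 'X) ^+ k *: map_mx polyC (pw k)))) //.
    by rewrite /pw Nm map_mx0 scaler0 oppr0 sub0r opprK expr0 scale1r /= map_mx1.
  by move=> k _; rewrite opprK addrC.
have /(congr1 determinant) := BA; rewrite det_mulmx det1 => dBA.
have /size_poly1P [c _ dA] : size (\det A) == 1%N.
  have : \det A \is a GRing.unit by apply/unitrPr; exists (\det B); rewrite mulrC.
  by rewrite poly_unitE => /andP[].
have ev a : \det (1%:M + a *: N) = c.
  have -> : 1%:M + a *: N = map_mx (horner_eval a) A.
    apply/matrixP => i j; rewrite !mxE /horner_eval /= hornerD hornerM hornerX hornerC.
    by rewrite hornerMn hornerC.
  by rewrite det_map_mx dA /= /horner_eval hornerC.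
by rewrite -[N in LHS]scale1r ev -(ev 0) scale0r addr0 det1.
Qed.

(** * Smooth maps between normed modules *)

Lemma biscalar_mxE (R : realType) p
    (B : {bilinear 'rV[R]_p -> 'rV[R]_p -> R | *%R & *%R}) u v :
  B u v = (u *m form_matrix B *m v^T) 0 0.
Proof.
rewrite {1}(row_sum_delta u) linear_sumlz -mulmxA mxE; apply: eq_bigr => i _.
rewrite linearZl /=; congr (_ * _).
rewrite {1}(row_sum_delta v) linear_sumr mxE; apply: eq_bigr => j _.
by rewrite linearZr /= !mxE mulrC.
Qed.

Section ContinuousBilinear.
Context {R : realType}.

(** A predicate on bare functions, so that the algebra product, the form and scaling share one
    product rule. *)
Definition continuous_bilinear (U V W : normedModType R) (B : U -> V -> W) :=
  bilinear_for *:%R *:%R B /\ continuous (fun p : U * V => B p.1 p.2).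

Lemma is_diff_bilinear (E U V W : normedModType R) (B : U -> V -> W)
    (f : E -> U) (g : E -> V) (df : E -> U) (dg : E -> V) x :
  continuous_bilinear B -> is_diff x f df -> is_diff x g dg ->
  is_diff x (fun y => B (f y) (g y)) (fun v => B (df v) (g x) + B (f x) (dg v)).
Proof.
move=> [Bb Bc] dfx dgx.
pose Bm := bilinear_isBilinear.Build _ _ _ _ _ _ B Bb.
pose BL : {bilinear U -> V -> W} := HB.pack B Bm.
have BLc : continuous (fun p : U * V => BL p.1 p.2) by exact: Bc.
have dB : is_diff (f x, g x) (fun p : U * V => BL p.1 p.2)
    (fun q => BL (f x) q.2 + BL q.1 (g x)).
  apply: DiffDef; first exact: differentiable_bilin.
  by rewrite diff_bilin.
have := @is_diff_comp _ _ _ _ _ _ _ _ x (is_diff_pair dfx dgx) dB.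
by move/is_diff_eq; apply; apply/funext => v /=; rewrite addrC.
Qed.

Lemma continuous_big_sum (T : topologicalType) (W : normedModType R) (I : Type)
    (r : seq I) (f : I -> T -> W) :
  (forall i, continuous (f i)) -> continuous (fun x => \sum_(i <- r) f i x).
Proof.
move=> fc x; elim: r => [|i r IH].
  rewrite (_ : (fun _ => _) = cst 0); first exact: cst_continuous.
  by apply/funext => y; rewrite big_nil.
rewrite (_ : (fun _ => _) = f i \+ (fun y => \sum_(j <- r) f j y)).
  by apply: continuousD => //; exact: fc.
by apply/funext => y; rewrite big_cons.
Qed.

Lemma linear_rV_continuous n (W : normedModType R) (f : 'rV[R]_n -> W) :
  linear f -> continuous f.
Proof.
move=> fl; pose fm := GRing.isLinear.Build _ _ _ _ f fl.
pose fL : {linear 'rV[R]_n -> W} := HB.pack f fm.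
have -> : f = fun v => \sum_j v 0 j *: f 'e_j.
  apply/funext => v; rewrite -[f]/(fL : _ -> _) {1}(row_sum_delta v) linear_sum.
  by apply: eq_bigr => j _; rewrite linearZ.
apply: continuous_big_sum => j v; apply: continuousZr_tmp.
exact: coord_continuous.
Qed.

Lemma continuous_bilinear_rV n p (W : normedModType R) (B : 'rV[R]_n -> 'rV[R]_p -> W) :
  bilinear_for *:%R *:%R B -> continuous_bilinear B.
Proof.
move=> Bb; split=> //.
pose Bm := bilinear_isBilinear.Build _ _ _ _ _ _ B Bb.
pose BL : {bilinear 'rV[R]_n -> 'rV[R]_p -> W} := HB.pack B Bm.
have -> : (fun q : 'rV[R]_n * 'rV[R]_p => B q.1 q.2) =
    fun q => \sum_i \sum_j (q.1 0 i * q.2 0 j) *: B 'e_i 'e_j.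
  apply/funext => q; rewrite -[B]/(BL : _ -> _ -> _) {1}(row_sum_delta q.1).
  rewrite linear_sumlz; apply: eq_bigr => i _; rewrite linearZl /=.
  rewrite -[B]/(BL : _ -> _ -> _) {1}(row_sum_delta q.2) linear_sumr scaler_sumr.
  by apply: eq_bigr => j _; rewrite linearZr /= scalerA.
apply: continuous_big_sum => i; apply: continuous_big_sum => j -[u v].
apply: cvgZr_tmp; apply: cvgM => /=.
  by apply: (@cvg_comp _ _ _ fst (fun v : 'rV[R]_n => v 0 i) _ (nbhs u));
    [exact: cvg_fst|exact: coord_continuous].
by apply: (@cvg_comp _ _ _ snd (fun v : 'rV[R]_p => v 0 j) _ (nbhs v));
  [exact: cvg_snd|exact: coord_continuous].
Qed.

Lemma continuous_bilinear_scale (W : normedModType R) :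
  continuous_bilinear (fun (a : R) (w : W) => a *: w).
Proof.
split; last exact: scale_continuous.
split=> [u|u] a x y /=; first by rewrite scalerDl scalerA.
by rewrite scalerDr !scalerA mulrC.
Qed.

Lemma is_diff_linear (E V W : normedModType R) (L : V -> W) (f df : E -> V) x :
  linear L -> continuous L -> is_diff x f df ->
  is_diff x (fun y => L (f y)) (fun v => L (df v)).
Proof.
move=> Ll Lc dfx; pose Lm := GRing.isLinear.Build _ _ _ _ L Ll.
pose LL : {linear V -> W} := HB.pack L Lm.
have LLc : continuous LL by exact: Lc.
have dL : is_diff (f x) LL LL.
  by apply: DiffDef; [exact: linear_differentiable|exact: diff_lin].
exact: is_diff_comp.
Qed.

(** Differentiability is a property of the germ: the little-o expansion of [f] is also one of
    [g]. *)
Lemma near_is_diff (V W : normedModType R) (f g df : V -> W) x :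
  is_diff x f df -> {near x, f =1 g} -> is_diff x g df.
Proof.
move=> dfx fg.
have fgx : f x = g x by exact: nbhs_singleton fg.
have shift0 : \forall y \near (0 : V), f (y + x) = g (y + x).
  have : y + x @[y --> (0 : V)] --> 0 + x.
    by apply: cvgD; [exact: cvg_id|exact: cvg_cst].
  by rewrite add0r => /(_ _ fg).
have [dfc] := (diff_locallyP x f).1 (@ex_diff _ _ _ _ _ _ _ dfx).
move=> /eqaddoP fo.
have go : g \o shift x = cst (g x) + 'd f x +o_ 0 id.
  apply/eqaddoP => e e0; near=> y.
  have <- : (f \o shift x - (cst (f x) + 'd f x)) y = (g \o shift x - (cst (g x) + 'd f x)) y.
    rewrite !fctE /= fgx; congr (_ - _).
    by near: y; exact: shift0.
  by near: y; exact: fo.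
  apply: DiffDef.
    apply/diff_locallyP; rewrite (diff_unique dfc go); split=> //.
  by rewrite (diff_unique dfc go) diff_val.
Unshelve. all: by end_near. Qed.

(** * Closure properties of C^k maps *)

Section Smooth.
Context {V : normedModType R}.
Implicit Types (U : set V).

(** Since [U] is open, equality on [U] is equality of germs and passes to all derivatives. The
    closure rules below need it because they compute a derivative only at points of [U]. *)
Lemma Ck_on_ext (W : normedModType R) k U (f g : V -> W) :
  open U -> (forall x, U x -> f x = g x) -> Ck_on k U f -> Ck_on k U g.
Proof.
move=> Uo; elim: k f g => [|k IH] f g fg /=.
  move=> fc x Ux; rewrite /prop_for /continuous_at -(fg _ Ux).
  apply: cvg_trans (fc x Ux); apply: near_eq_cvg.
  by apply: filterS (open_nbhs_nbhs (conj Uo Ux)) => y Uy; rewrite fg.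
move=> [fd fk].
have gd x : U x -> is_diff x g ('d f x).
  move=> Ux; apply: (near_is_diff (differentiableP (fd x Ux))).
  by apply: filterS (open_nbhs_nbhs (conj Uo Ux)) => y Uy; exact: fg.
split=> [x /gd xd|v]; first exact: ex_diff.
by apply: IH (fk v) => x /gd gdx; rewrite diff_val.
Qed.

Lemma Ck_on_le (W : normedModType R) k U (f : V -> W) :
  Ck_on k.+1 U f -> Ck_on k U f.
Proof.
elim: k f => [|k IH] f [fd fk] /=.
  by move=> x /fd; exact: differentiable_continuous.
by split=> // v; exact: IH.
Qed.

Lemma Ck_on_cst (W : normedModType R) k U (w : W) : Ck_on k U (fun=> w).
Proof.
elim: k w => [|k IH] w /=; first by move=> x _; exact: cst_continuous.
split=> [x _|v]; first exact: differentiable_cst.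
have -> : (fun x : V => 'd (fun=> w) x v) = fun=> 0 by apply/funext => x; rewrite diff_cst.
exact: IH.
Qed.

Lemma Ck_on_linear (W : normedModType R) k U (f : V -> W) :
  linear f -> continuous f -> Ck_on k U f.
Proof.
move=> fl fc.
have fd x : is_diff x f f by exact: (is_diff_linear fl fc (is_diff_id x)).
case: k => [|k] /=; first by move=> x _; exact: fc.
split=> [x _|v]; first exact: ex_diff.
have -> : (fun x : V => 'd f x v) = fun=> f v by apply/funext => x; rewrite diff_val.
exact: Ck_on_cst.
Qed.

Lemma Ck_on_comp_linear (W W' : normedModType R) k U (L : W -> W') (f : V -> W) :
  open U -> linear L -> continuous L -> Ck_on k U f -> Ck_on k U (fun x => L (f x)).
Proof.
move=> Uo Ll Lc; elim: k f => [|k IH] f /=.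
  by move=> fc x /fc fx; apply: continuous_comp => //; exact: Lc.
move=> [fd fk].
have d x : U x -> is_diff x (fun x => L (f x)) (fun v => L ('d f x v)).
  by move=> /fd/differentiableP fdx; exact: is_diff_linear.
split=> [x /d xd|v]; first exact: ex_diff.
by apply: Ck_on_ext (IH _ (fk v)) => // x /d xd; rewrite diff_val.
Qed.

Lemma Ck_onD (W : normedModType R) k U (f g : V -> W) :
  open U -> Ck_on k U f -> Ck_on k U g -> Ck_on k U (fun x => f x + g x).
Proof.
move=> Uo; elim: k f g => [|k IH] f g /=.
  by move=> fc gc x Ux; apply: continuousD; [exact: fc|exact: gc].
move=> [fd fk] [gd gk].
have d x : U x -> is_diff x (fun x => f x + g x) (fun v => 'd f x v + 'd g x v).
  by move=> Ux; exact: (is_diffD (differentiableP (fd x Ux)) (differentiableP (gd x Ux))).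
split=> [x /d xd|v]; first exact: ex_diff.
by apply: Ck_on_ext (IH _ _ (fk v) (gk v)) => // x /d xd; rewrite diff_val.
Qed.

Lemma Ck_on_bilinear (U1 U2 W : normedModType R) (B : U1 -> U2 -> W) k U
    (f : V -> U1) (g : V -> U2) :
  open U -> continuous_bilinear B -> Ck_on k U f -> Ck_on k U g ->
  Ck_on k U (fun x => B (f x) (g x)).
Proof.
move=> Uo Bb; elim: k f g => [|k IH] f g.
  move=> fc gc x Ux.
  apply: (@continuous_comp _ _ _ (fun x => (f x, g x)) (fun p => B p.1 p.2)).
    by apply: cvg_pair; [exact: fc|exact: gc].
  exact: Bb.2.
move=> fk1 gk1; have [fd fk] := fk1; have [gd gk] := gk1.
have d x : U x -> is_diff x (fun x => B (f x) (g x))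
    (fun v => B ('d f x v) (g x) + B (f x) ('d g x v)).
  by move=> Ux; apply: is_diff_bilinear => //; apply/differentiableP; [exact: fd|exact: gd].
split=> [x /d xd|v]; first exact: ex_diff.
apply: Ck_on_ext (Ck_onD Uo (IH _ _ (fk v) (Ck_on_le gk1)) (IH _ _ (Ck_on_le fk1) (gk v))) => //.
by move=> x /d xd; rewrite diff_val.
Qed.

Lemma Ck_on_sum (W : normedModType R) k U (I : Type) (r : seq I) (f : I -> V -> W) :
  open U -> (forall i, Ck_on k U (f i)) -> Ck_on k U (fun x => \sum_(i <- r) f i x).
Proof.
move=> Uo fk; elim: r => [|i r IH].
  by apply: Ck_on_ext (@Ck_on_cst W k U 0) => // x _; rewrite big_nil.
by apply: Ck_on_ext (Ck_onD Uo (fk i) IH) => // x _; rewrite big_cons.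
Qed.

Lemma Ck_on_pair (W W' : normedModType R) k U (f : V -> W) (g : V -> W') :
  open U -> Ck_on k U f -> Ck_on k U g -> Ck_on k U (fun x => (f x, g x)).
Proof.
move=> Uo; elim: k f g => [|k IH] f g /=.
  by move=> fc gc x Ux; apply: cvg_pair; [exact: fc|exact: gc].
move=> [fd fk] [gd gk].
have d x : U x -> is_diff x (fun x => (f x, g x)) (fun v => ('d f x v, 'd g x v)).
  by move=> Ux; apply: is_diff_pair; apply/differentiableP; [exact: fd|exact: gd].
split=> [x /d xd|v]; first exact: ex_diff.
by apply: Ck_on_ext (IH _ _ (fk v) (gk v)) => // x /d xd; rewrite diff_val.
Qed.

(** [Ck_on] controls derivatives along fixed vectors, whereas the chain rule evaluates ['d g (f x)]
    at the moving vector ['d f x v]. Expanding that vector in the standard basis leaves a sum of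
    products of C^k maps. *)
Lemma Ck_on_comp n (W : normedModType R) k U (f : V -> 'rV[R]_n) (g : 'rV[R]_n -> W) :
  open U -> Ck_on k U f -> Ck_on k setT g -> Ck_on k U (fun x => g (f x)).
Proof.
move=> Uo; elim: k g => [|k IH] g.
  by move=> fc gc x Ux; apply: continuous_comp; [exact: fc|exact: gc].
move=> fk1 [gd gk]; have [fd fk] := fk1.
have d x : U x -> is_diff x (fun x => g (f x)) (fun v => 'd g (f x) ('d f x v)).
  move=> /fd/differentiableP fdx; have /differentiableP gdx := gd (f x) I.
  exact: is_diff_comp.
split=> [x /d xd|v]; first exact: ex_diff.
have gki i : Ck_on k U (fun x => 'd g (f x) 'e_i) := IH _ (Ck_on_le fk1) (gk 'e_i).
have cl i : linear (fun u : 'rV[R]_n => u 0 i) by move=> a u w; rewrite !mxE.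
have fki i : Ck_on k U (fun x => 'd f x v 0 i).
  exact: Ck_on_comp_linear (cl i) (@coord_continuous _ _ _ _ _) (fk v).
apply: Ck_on_ext (Ck_on_sum (index_enum _) Uo (fun i =>
  Ck_on_bilinear Uo (continuous_bilinear_scale W) (fki i) (gki i))) => //.
move=> x /d xd; rewrite diff_val [in RHS](row_sum_delta ('d f x v)) linear_sum.
by apply: eq_bigr => i _; rewrite linearZ.
Qed.

End Smooth.

Lemma is_diff0_segment (V : normedModType R) (f : V -> R) x y :
  (forall t : R, 0 <= t <= 1 -> is_diff (x + t *: (y - x)) f (fun=> 0)) -> f y = f x.
Proof.
move=> fd; pose g t := f (x + t *: (y - x)).
have gd (t : R) : 0 <= t <= 1 -> is_diff t g (fun=> 0).
  move=> /fd fdt.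
  have ld : is_diff t (fun t : R => x + t *: (y - x)) (0 + *:%R^~ (y - x)).
    exact: is_diffD.
  exact: is_diff_comp.
have [||c _] := @MVT_segment R g (fun=> 0) 0 1 ler01.
- move=> t /[!in_itv] /andP[t0 t1].
  have gdt : is_diff t g (fun=> 0) by apply: gd; rewrite !ltW.
  apply: DeriveDef; first exact/diff_derivable/ex_diff.
  by rewrite deriveE ?diff_val //; exact: ex_diff.
- apply: continuous_in_subspaceT => t; rewrite inE /= in_itv /= => t01.
  exact: differentiable_continuous (@ex_diff _ _ _ _ _ _ _ (gd t t01)).
by rewrite mul0r /g scale1r scale0r addr0 subrKC => /eqP; rewrite subr_eq0 => /eqP.
Qed.

End ContinuousBilinear.

(** * Differential geometry of the potential *)

Lemma is_diff_big_sum (R : realType) (V W : normedModType R) (I : Type) (r : seq I)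
    (f df : I -> V -> W) x :
  (forall i, is_diff x (f i) (df i)) ->
  is_diff x (fun y => \sum_(i <- r) f i y) (fun v => \sum_(i <- r) df i v).
Proof.
move=> fd; elim: r => [|i r IH].
  have -> : (fun y => \sum_(i <- [::]) f i y) = cst 0 by apply/funext => y; rewrite big_nil.
  by apply: is_diff_eq; apply/funext => v; rewrite big_nil.
have -> : (fun y => \sum_(i <- i :: r) f i y) = f i + (fun y => \sum_(i <- r) f i y).
  by apply/funext => y; rewrite big_cons.
by apply: is_diff_eq; apply/funext => v; rewrite big_cons.
Qed.

Lemma is_diff_unique (R : realType) (V W : normedModType R) (f df dg : V -> W) x :
  is_diff x f df -> is_diff x f dg -> df = dg.
Proof. by move=> d d'; rewrite -(@diff_val _ _ _ _ _ _ _ d) -(@diff_val _ _ _ _ _ _ _ d'). Qed.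

Lemma linear_funN (R : realType) (V W : lmodType R) (L : V -> W) v :
  linear L -> L (- v) = - L v.
Proof.
by move=> Ll; have := scalable_linear Ll (-1) v; rewrite scaleN1r => ->; exact: scaleN1r.
Qed.

Section MetrisedJordan.
Context {R : realType} {n : nat}.
Variable mul : {bilinear 'rV[R]_n -> 'rV[R]_n -> 'rV[R]_n}.
Variable gamma : {bilinear 'rV[R]_n -> 'rV[R]_n -> R | *%R & *%R}.
Local Notation "x ** y" := (mul x y) (at level 40, left associativity).
Implicit Types (x y z u v w : 'rV[R]_n).

Hypothesis mulC : forall x y, x ** y = y ** x.
Hypothesis jordan : forall x y, x ** ((x ** x) ** y) = (x ** x) ** (x ** y).
Variable m : nat.
Hypothesis mul_nil : forall x v, iter m (mul x) v = 0.
Hypothesis gammaC : forall u v, gamma u v = gamma v u.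
Hypothesis gammaA : forall u v w, gamma (u ** v) w = gamma u (v ** w).
Hypothesis gamma_nd : nondegenerate_form gamma.

Local Notation quasi := (quasi mul m).
Local Notation resolvent := (resolvent mul m).
Local Notation pow := (pow mul).

Lemma mul_continuous_bilinear : continuous_bilinear mul.
Proof.
by apply: continuous_bilinear_rV; split=> [u|u] a v w; rewrite ?linearPl ?linearPr.
Qed.

Lemma gamma_continuous_bilinear : continuous_bilinear (gamma : _ -> _ -> R).
Proof.
apply: (@continuous_bilinear_rV R n n R).
by split=> [u|u] a v w; rewrite ?linearPl ?linearPr.
Qed.

Let mulB := mul_continuous_bilinear.
Let gammaB := gamma_continuous_bilinear.

Fixpoint dpow k x v : 'rV[R]_n :=
  if k is k'.+1 then v ** pow x k' + x ** dpow k' x v else v.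

Lemma is_diff_pow k x : is_diff x (fun y => pow y k) (dpow k x).
Proof.
elim: k => [|k IH]; first exact: is_diff_id.
exact: (is_diff_bilinear mulB (is_diff_id x) IH).
Qed.

Lemma Ck_on_pow j k : Ck_on j setT (fun x => pow x k).
Proof.
elim: k => [|k IH]; first by apply: Ck_on_linear => // x; exact: cvg_id.
apply: (Ck_on_bilinear openT mulB) => //.
by apply: Ck_on_linear => // x; exact: cvg_id.
Qed.

Lemma smooth_quasi : smooth_on setT quasi.
Proof.
move=> j; apply: Ck_on_sum => [|k]; first exact: openT.
apply: (Ck_on_bilinear openT (continuous_bilinear_scale _)); first exact: Ck_on_cst.
exact: Ck_on_pow.
Qed.

Lemma smooth_resolvent (f g : 'rV[R]_n -> 'rV[R]_n) :
  smooth_on setT f -> smooth_on setT g ->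
  smooth_on setT (fun x => resolvent (f x) (g x)).
Proof.
move=> fs gs j; apply: Ck_on_sum => [|k]; first exact: openT.
apply: (Ck_on_bilinear openT (continuous_bilinear_scale _)); first exact: Ck_on_cst.
by elim: (k : nat) => [|i IH] //=; exact: (Ck_on_bilinear openT mulB).
Qed.

Lemma resolvent_linear x : linear (resolvent x).
Proof.
move=> a u v; apply: (one_plus_mul_inj mul_nil (x := x)).
by rewrite linearPr addrACA -scalerDr !resolventP.
Qed.

(* Found by differentiating [quasi x + x ** quasi x = x]; it is the inverse of the
   quadratic representation of [1 + x] in the unital hull. *)
Definition quasi_deriv x v := resolvent x (v - v ** quasi x).
Local Notation H := quasi_deriv.

Lemma quasi_derivP x v : H x v + x ** H x v = v - v ** quasi x.
Proof. exact: resolventP. Qed.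

Lemma quasi_deriv_linear x : linear (H x).
Proof.
move=> a u v; rewrite /H -resolvent_linear; congr resolvent.
by rewrite linearPl scalerBr opprD addrACA.
Qed.

(** Differentiating [f + a f = g] gives [(1 + L_a) df = dg - da f], which determines [df] by
    injectivity of [1 + L_a]. Differentiability is supplied by polynomiality wherever the lemma is
    applied. *)
Lemma is_diff_implicit (V : normedModType R) (f g df dg : V -> 'rV[R]_n)
    (a da : V -> 'rV[R]_n) (p : V) :
  (forall q, f q + a q ** f q = g q) -> is_diff p a da -> is_diff p g dg ->
  differentiable f p -> (forall d, df d + a p ** df d = dg d - da d ** f p) ->
  is_diff p f df.
Proof.
move=> fg dax dgx fd dfE; apply: DiffDef => //.
apply/funext => v; apply: (one_plus_mul_inj mul_nil (x := a p)); rewrite dfE.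
have /differentiableP fx := fd.
have := is_diffD fx (is_diff_bilinear mulB dax fx).
have -> : f + (fun q => a q ** f q) = g by apply/funext.
move=> /is_diff_unique/(_ dgx) <-.
by rewrite fctE [X in _ + X - _]addrC addrA addrK.
Qed.

Lemma is_diff_quasi x : is_diff x quasi (H x).
Proof.
apply: (is_diff_implicit (quasiP mul_nil)) => //.
  by have [] := smooth_quasi 1; move=> + _; apply.
exact: quasi_derivP.
Qed.

(** Applying [1 + L_x] to both sides leaves [(x w) (quasi x) = x ((quasi x) w)], the commutation of
    [L_x] with [L_(quasi x)]. *)
Lemma quasi_deriv_mul x w : H x (w + x ** w) = w - quasi x ** w.
Proof.
apply: (one_plus_mul_inj mul_nil (x := x)); rewrite quasi_derivP.
rewrite linearDl linearBr opprD addrACA (mulC w); congr (_ + (_ - _)).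
by rewrite mulC (commuting_quasi mulC jordan).
Qed.

Lemma gamma_quasi_deriv x u v : gamma (H x u) v = gamma u (H x v).
Proof.
(* Writing [v] as [w + x w] lets [1 + L_x] cross the form and cancel the resolvent in [H x u]. *)
rewrite -[v](resolventP mul_nil x); set w := resolvent x v.
rewrite quasi_deriv_mul linearDr /= -gammaA (mulC _ x) -linearDl quasi_derivP.
by rewrite linearBl linearBr gammaA.
Qed.

Lemma quasi_deriv_inj x : injective (H x).
Proof.
move=> u v uv; have := congr1 (fun w => w + x ** w) uv; rewrite !quasi_derivP.
rewrite !(mulC _ (quasi x)) -!linearNl.
exact: (one_plus_mul_inj mul_nil).
Qed.

Definition quasi_deriv_inv x v := resolvent (- quasi x) (v + x ** v).

Lemma quasi_deriv_invK x v : H x (quasi_deriv_inv x v) = v.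
Proof.
apply: (one_plus_mul_inj mul_nil (x := x)); rewrite quasi_derivP.
by rewrite (mulC _ (quasi x)) -linearNl resolventP.
Qed.

(** Each of the [k + 1] factors of the power contributes the same value once associativity has moved
    the others across the form; the free [j] collects the factors moved during the induction. *)
Lemma gamma_dpow j k x u :
  gamma (pow x j) (dpow k x u) = k.+1%:R * gamma u (pow x (j + k)).
Proof.
elim: k j => [|k IH] j /=; first by rewrite addn0 mul1r gammaC.
rewrite linearDr /= -!gammaA (mulC _ u) gammaA pow_mul // mulC -[x ** _]/(pow x j.+1) IH.
by rewrite addnS addSn -[k.+2]addn1 natrD mulrDl mul1r addrC.
Qed.

Definition potential x := \sum_(k < m) ((-1) ^+ k / k.+2%:R) * gamma x (pow x k).

(** The [k + 2] factors [x] of [gamma x (pow x k)] contribute equally to the derivative. This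
    cancels the denominator of the coefficient and leaves the alternating series of [quasi x]. *)
Lemma is_diff_potential x : is_diff x potential (fun u => gamma u (quasi x)).
Proof.
have d k : is_diff x (fun y => ((-1) ^+ k / k.+2%:R) * gamma y (pow y k))
    (fun u => (-1) ^+ k * gamma u (pow x k)).
  have := is_diff_bilinear gammaB (is_diff_id x) (is_diff_pow k x).
  move=> /(is_diffZ ((-1) ^+ k / k.+2%:R))/is_diff_eq; apply.
  apply/funext => u; rewrite !fctE (gamma_dpow 0 k x u : gamma x (dpow k x u) = _) add0n.
  have -> : gamma u (pow x k) + k.+1%:R * gamma u (pow x k) = k.+2%:R * gamma u (pow x k).
    by rewrite [k.+2%:R]mulrS mulrDl mul1r.
  by rewrite -[_ *: _]/(_ * _) mulrA divfK // pnatr_eq0.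
have := @is_diff_big_sum _ _ _ _ (index_enum 'I_m) _ _ x (fun k : 'I_m => d k).
move/is_diff_eq; apply; apply/funext => u.
by rewrite quasiE linear_sumr; apply: eq_bigr => k _; rewrite linearZr.
Qed.

Lemma smooth_potential : smooth_on setT potential.
Proof.
move=> j; apply: Ck_on_sum => [|k]; first exact: openT.
apply: (Ck_on_bilinear openT (continuous_bilinear_scale R)); first exact: Ck_on_cst.
apply: (Ck_on_bilinear openT gammaB); last exact: Ck_on_pow.
by apply: Ck_on_linear => // x; exact: cvg_id.
Qed.

Lemma jordan_F_termE x k : jordan_F_term mul gamma x k.+2 =
  ((-1) ^+ k / k.+2%:R) * gamma x (pow x k).
Proof. by rewrite /jordan_F_term !exprS !mulN1r opprK. Qed.

Lemma jordan_F_partial x N : (m.+2 <= N)%N ->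
  \sum_(2 <= k < N) jordan_F_term mul gamma x k = potential x.
Proof.
move=> mN; rewrite /potential.
rewrite -(big_mkord xpredT (fun k => (-1) ^+ k / k.+2%:R * gamma x (pow x k))).
(* The index of the series is that of [potential] plus two, and [pow x k] vanishes from [k = m]
   on. *)
rewrite (@big_cat_nat _ _ _ m.+2) //= [X in _ + X]big_nat_cond [X in _ + X]big1.
  rewrite addr0 -[2%N]addn0 -[m.+2]addn2 addnC big_addn addnK.
  by apply: eq_big_nat => k _; rewrite addn2 jordan_F_termE.
move=> [|[|k]] //; rewrite andbT => /andP[mk _].
rewrite jordan_F_termE /pow (mul_nil_ge mul_nil) ?linear0r ?mulr0 //.
Qed.

Lemma jordan_F_cvg x :
  (fun N => \sum_(2 <= k < N) jordan_F_term mul gamma x k) @ \oo --> potential x.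
Proof.
apply: cvg_near_cst; exists m.+2 => // N /= mN; exact: jordan_F_partial.
Qed.

Lemma jordan_FE : jordan_F mul gamma = potential.
Proof. by apply/funext => x; apply: cvg_lim => //; exact: jordan_F_cvg. Qed.

(** * The exponential of a multiplication operator *)

Definition expL y v := \sum_(k < m) (k`!%:R)^-1 *: iter k (mul y) v.

(* The value at [L_y] of the power series [(exp t - 1) / t]. *)
Definition expL1 y v := \sum_(k < m) (k.+1`!%:R)^-1 *: iter k (mul y) v.

Lemma expL_linear y : linear (expL y).
Proof.
move=> a u v; rewrite /expL scaler_sumr -big_split; apply: eq_bigr => k _ /=.
by rewrite iter_mulD iter_mulZ scalerDr !scalerA mulrC.
Qed.

Lemma expLD y u v : expL y (u + v) = expL y u + expL y v.
Proof. by have := expL_linear y 1 u v; rewrite !scale1r. Qed.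

Lemma expL0v y : expL y 0 = 0.
Proof.
have := expL_linear y 1 0 0; rewrite !scale1r !addr0 => /esym/eqP.
by rewrite -subr_eq0 addrK => /eqP.
Qed.

Lemma expLN y u : expL y (- u) = - expL y u.
Proof. by have := expL_linear y (-1) u 0; rewrite !scaleN1r expL0v !addr0. Qed.

Lemma expL0 v : expL 0 v = v.
Proof.
(* For [m = 0] the sum is empty, but then [mul_nil] says that every vector is [0]. *)
rewrite /expL; case: m mul_nil => [/(_ 0 v) /= ->|k _]; first by rewrite big_ord0.
rewrite big_ord_recl big1 => [|i _].
  by rewrite addr0 invr1 scale1r.
by rewrite /= linear0l scaler0.
Qed.

Lemma mul_expL1 y v : y ** expL1 y v = expL y v - v.
Proof.
have -> : expL y v = \sum_(k < m.+1) (k`!%:R)^-1 *: iter k (mul y) v.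
  by rewrite big_ord_recr /= mul_nil scaler0 addr0.
rewrite big_ord_recl /= invr1 scale1r addrAC subrr add0r linear_sumr.
by apply: eq_bigr => k _; rewrite linearZr.
Qed.

Lemma gamma_expL y u v : gamma (expL y u) v = gamma u (expL y v).
Proof.
rewrite linear_sumlz linear_sumr; apply: eq_bigr => k _.
rewrite linearZl linearZr /=; congr (_ * _).
elim: (k : nat) u v => //= i IH u v.
by rewrite (mulC y) gammaA IH -iterS iterSr.
Qed.

Lemma expL_mul (t : R) y v : y ** expL (t *: y) v = expL (t *: y) (y ** v).
Proof.
rewrite linear_sumr; apply: eq_bigr => k _.
by rewrite linearZr /= !iter_mulZl linearZr /= -iterS iterSr.
Qed.

Lemma is_diff_expr k (t : R) :
  is_diff t (fun s : R => s ^+ k) (fun s => s * (k%:R * t ^+ k.-1)).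
Proof.
have -> : (fun s : R => s ^+ k) = id ^+ k by apply/funext => s; rewrite exprfctE.
have := is_deriveX k (is_derive_id t (1 : R)).
move=> dk; apply: DiffDef; first exact/derivable1_diffP/ex_derive.
have dk' : derivable (id ^+ k : R -> R) t 1 by exact: ex_derive.
by rewrite deriv1E // derive1E derive_val; apply/funext => s /=; rewrite [_ *: 1]mulr1.
Qed.

Lemma mulf_fact k (a : R) : k.+1%:R * a / k.+1`!%:R = a / k`!%:R.
Proof. by rewrite factS natrM -mulf_div divff ?mul1r // pnatr_eq0. Qed.

Lemma is_diff_iter_mul (z : R -> 'rV[R]_n) dz y k (t : R) :
  is_diff t z ( *:%R^~ dz) ->
  is_diff t (fun s => iter k (mul y) (z s)) ( *:%R^~ (iter k (mul y) dz)).
Proof.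
move=> zd; elim: k => //= k IH.
have := is_diff_bilinear mulB (is_diff_cst y t) IH.
by move/is_diff_eq; apply; apply/funext => s; rewrite linear0l add0r linearZr.
Qed.

(** The argument [z] moves with [t], so that the rule applies to nested exponentials and to [quasi]
    along a curve. *)
Lemma is_diff_expL (z : R -> 'rV[R]_n) dz y (t : R) :
  is_diff t z ( *:%R^~ dz) ->
  is_diff t (fun s => expL (s *: y) (z s)) ( *:%R^~ (expL (t *: y) (y ** z t + dz))).
Proof.
move=> zd.
have -> : (fun s => expL (s *: y) (z s)) =
    fun s => \sum_(k < m) s ^+ k *: ((k`!%:R)^-1 *: iter k (mul y) (z s)).
  apply/funext => s; apply: eq_bigr => k _.
  by rewrite iter_mulZl !scalerA mulrC.
have d k := is_diff_bilinear (continuous_bilinear_scale _) (is_diff_expr k t)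
  (is_diffZ (k`!%:R)^-1 (is_diff_iter_mul y k zd)).
have := @is_diff_big_sum _ _ _ _ (index_enum 'I_m) _ _ t (fun k : 'I_m => d k).
move/is_diff_eq; apply; apply/funext => s.
rewrite expLD scalerDr big_split /=; congr (_ + _); last first.
  rewrite /expL scaler_sumr; apply: eq_bigr => k _.
  by rewrite iter_mulZl fctE /= !scalerA; congr (_ *: _); ring.
rewrite /expL scaler_sumr.
(* The added term [k = m] is zero by nilpotency; after the shift of index the sum has the range of
   [expL]. *)
transitivity (\sum_(k < m.+1) (s * (k%:R * t ^+ k.-1)) *: ((k`!%:R)^-1 *: iter k (mul y) (z t))).
  by rewrite big_ord_recr /= mul_nil !scaler0 addr0.
rewrite big_ord_recl /= mul0r mulr0 scale0r add0r; apply: eq_bigr => k _.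
rewrite iter_mulZl -iterSr !scalerA; congr (_ *: _).
rewrite -[bump 0 k]/(k.+1) add0n -!mulrA; congr (_ * _).
by rewrite mulrA mulf_fact mulrC.
Qed.

Lemma is_diff_expL1 y (t : R) :
  is_diff t (fun s => expL1 (s *: y) (s *: y)) ( *:%R^~ (expL (t *: y) y)).
Proof.
have -> : (fun s : R => expL1 (s *: y) (s *: y)) =
    fun s => \sum_(k < m) s ^+ k.+1 *: ((k.+1`!%:R)^-1 *: iter k (mul y) y).
  apply/funext => s; apply: eq_bigr => k _.
  by rewrite iter_mulZl iter_mulZ !scalerA; congr (_ *: _); rewrite exprSr mulrC.
have d k := is_diff_bilinear (continuous_bilinear_scale _) (is_diff_expr k.+1 t)
  (is_diff_cst ((k.+1`!%:R)^-1 *: iter k (mul y) y) t).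
have := @is_diff_big_sum _ _ _ _ (index_enum 'I_m) _ _ t (fun k : 'I_m => d k).
move/is_diff_eq; apply; apply/funext => s.
rewrite /expL scaler_sumr; apply: eq_bigr => k _.
rewrite scaler0 addr0 iter_mulZl !scalerA; congr (_ *: _).
by rewrite -!mulrA; congr (_ * _); rewrite mulrA mulf_fact mulrC.
Qed.

Lemma is_diff0_cst (f : R -> 'rV[R]_n) :
  (forall t, is_diff t f (fun=> 0)) -> f 1 = f 0.
Proof.
move=> fd; apply/rowP => i.
apply: (@is_diff0_segment R R (fun t => f t 0 i) 0 1) => t _.
have := fd (0 + t *: (1 - 0)).
have cl : linear (fun u : 'rV[R]_n => u 0 i) by move=> a u w; rewrite !mxE.
move/(is_diff_linear cl (@coord_continuous _ _ _ 0 i))/is_diff_eq; apply.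
by apply/funext => s; rewrite mxE.
Qed.

(* Both sides, with [y] replaced by [t y], have the same velocity in [t]; likewise
   for [expL_expL1] and [expL_quasi]. *)
Lemma expLK y v : expL y (expL (- y) v) = v.
Proof.
pose f t := expL (t *: y) (expL (t *: - y) v).
have fd t : is_diff t f (fun=> 0).
  have zd : is_diff t (fun=> v) ( *:%R^~ (0 : 'rV[R]_n)).
    by apply: is_diff_eq; apply/funext => s; rewrite scaler0.
  have := is_diff_expL y (is_diff_expL (- y) zd).
  move/is_diff_eq; apply.
  apply/funext => s; rewrite addr0 -expL_mul.
  by rewrite linearNl subrr expL0v scaler0.
by have := is_diff0_cst fd; rewrite /f !scale1r !scale0r !expL0.
Qed.

Lemma expLNK y v : expL (- y) (expL y v) = v.
Proof. by rewrite -{2}[y]opprK expLK. Qed.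

Lemma mul_expL1_scale (t : R) y : y ** expL1 (t *: y) (t *: y) = expL (t *: y) y - y.
Proof.
rewrite -mul_expL1 linearZl /= -linearZr /=; congr (_ ** _).
by rewrite /expL1 scaler_sumr; apply: eq_bigr => k _; rewrite iter_mulZ !scalerA mulrC.
Qed.

Lemma expL1_0 : expL1 0 0 = 0.
Proof. by apply: big1 => k _; rewrite -[in iter _ _ 0](scale0r 0) iter_mulZ scale0r scaler0. Qed.

Lemma expL_expL1 y : expL y (expL1 (- y) (- y)) = - expL1 y y.
Proof.
pose f t := expL (t *: y) (expL1 (t *: - y) (t *: - y)) + expL1 (t *: y) (t *: y).
have fd t : is_diff t f (fun=> 0).
  have := is_diffD (is_diff_expL y (is_diff_expL1 (- y) t)) (is_diff_expL1 y t).
  move/is_diff_eq; apply; apply/funext => s.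
  rewrite fctE -scalerDr -expLD -[y ** _]opprK -linearNl mul_expL1_scale.
  by rewrite -addrA opprK addNr expL0v scaler0.
have := is_diff0_cst fd; rewrite /f !scale1r !scale0r expL1_0 expL0v addr0.
by move/eqP; rewrite addr_eq0 => /eqP.
Qed.

Lemma expL_quasi y x :
  expL y (quasi (expL y x + expL1 y y)) = quasi x + expL1 y y.
Proof.
pose g t := expL (t *: y) x + expL1 (t *: y) (t *: y).
pose f t := expL (t *: y) (quasi (g t)) - expL1 (t *: y) (t *: y).
have gd t : is_diff t g ( *:%R^~ (y ** g t + y)).
  have zd : is_diff t (fun=> x) ( *:%R^~ (0 : 'rV[R]_n)).
    by apply: is_diff_eq; apply/funext => s; rewrite scaler0.
  have := is_diffD (is_diff_expL y zd) (is_diff_expL1 y t).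
  move/is_diff_eq; apply; apply/funext => s.
  by rewrite fctE -scalerDr /g linearDr mul_expL1_scale expL_mul addr0 addrA subrK.
have fd t : is_diff t f (fun=> 0).
  have qd : is_diff t (fun s => quasi (g s)) ( *:%R^~ (y - y ** quasi (g t))).
    (* With [g' = y + y g], [quasi_deriv_mul] gives [(quasi g)' = y - y (quasi g)]. The exponential
       in [f] cancels the linear part, and the derivative of [expL1] cancels the rest. *)
    have := is_diff_comp (gd t) (is_diff_quasi (g t)).
    move/is_diff_eq; apply; apply/funext => s /=.
    pose HL := GRing.isLinear.Build _ _ _ _ (H (g t)) (@quasi_deriv_linear (g t)).
    pose HL' : {linear 'rV[R]_n -> 'rV[R]_n} := HB.pack (H (g t)) HL.
    rewrite -[H (g t)]/(HL' : _ -> _) linearZ /=; congr (_ *: _).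
    by rewrite addrC (mulC y) quasi_deriv_mul (mulC y).
  have := is_diffB (is_diff_expL y qd) (is_diff_expL1 y t).
  move/is_diff_eq; apply; apply/funext => s.
  by rewrite addrCA subrr addr0 fctE subrr.
have := is_diff0_cst fd; rewrite /f /g !scale1r !scale0r expL1_0 !expL0 subr0 addr0.
by move/eqP; rewrite subr_eq => /eqP.
Qed.

(** * Higher derivatives of the quasi-inverse and Christoffel symbols *)

Definition quasi_deriv2 x u v := resolvent x (- (v ** H x u) - u ** H x v).
Local Notation D2 := quasi_deriv2.

Definition quasi_deriv3 x s u v :=
  resolvent x (- (v ** D2 x s u) - u ** D2 x s v - s ** D2 x u v).
Local Notation D3 := quasi_deriv3.

Lemma smooth_id : smooth_on setT (id : 'rV[R]_n -> 'rV[R]_n).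
Proof. by move=> k; apply: Ck_on_linear => // x; exact: cvg_id. Qed.

Lemma smooth_cst (W : normedModType R) (w : W) :
  smooth_on setT (fun=> w : W) (V := 'rV[R]_n).
Proof. by move=> k; exact: Ck_on_cst. Qed.

Lemma smoothD (W : normedModType R) (f g : 'rV[R]_n -> W) :
  smooth_on setT f -> smooth_on setT g -> smooth_on setT (fun x => f x + g x).
Proof. by move=> fs gs k; exact: (Ck_onD openT). Qed.

Lemma smooth_linear (W : normedModType R) (L : 'rV[R]_n -> W) f :
  linear L -> smooth_on setT f -> smooth_on setT (fun x : 'rV[R]_n => L (f x)).
Proof.
by move=> Ll fs k; exact: (Ck_on_comp_linear openT Ll (linear_rV_continuous Ll)).
Qed.

Lemma smoothN f : smooth_on setT f -> smooth_on setT (fun x : 'rV[R]_n => - f x : 'rV[R]_n).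
Proof. by apply: smooth_linear => a u v; rewrite opprD scalerN. Qed.

Lemma smooth_mul (f g : 'rV[R]_n -> 'rV[R]_n) : smooth_on setT f -> smooth_on setT g ->
  smooth_on setT (fun x => f x ** g x).
Proof. by move=> fs gs k; exact: (Ck_on_bilinear openT mulB). Qed.

Lemma smooth_quasi_deriv (f g : 'rV[R]_n -> 'rV[R]_n) : smooth_on setT f ->
  smooth_on setT g -> smooth_on setT (fun x => H (f x) (g x)).
Proof.
move=> fs gs; apply: smooth_resolvent => //; apply: smoothD => //; apply: smoothN.
apply: smooth_mul => // k; apply: (Ck_on_comp openT); [exact: fs|exact: smooth_quasi].
Qed.

Lemma smooth_quasi_deriv2 u v : smooth_on setT (fun x => D2 x u v).
Proof.
have Hs w : smooth_on setT (fun x => H x w).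
  by apply: smooth_quasi_deriv; [exact: smooth_id|exact: smooth_cst].
apply: smooth_resolvent; first exact: smooth_id.
by apply: smoothD; apply: smoothN; apply: smooth_mul => //; exact: smooth_cst.
Qed.

Lemma smooth_diff (V W : normedModType R) (f : V -> W) p : smooth_on setT f -> differentiable f p.
Proof. by move=> /(_ 1) [+ _]; apply. Qed.

Lemma is_diff_mull v (f df : 'rV[R]_n -> 'rV[R]_n) x :
  is_diff x f df -> is_diff x (fun y => v ** f y) (fun u => v ** df u).
Proof.
move=> fd; have := is_diff_bilinear mulB (is_diff_cst v x) fd.
by move/is_diff_eq; apply; apply/funext => u; rewrite linear0l add0r.
Qed.

(** Differentiating [quasi_derivP] gives an equation with the same operator [1 + L_x], solved by
    [D2]; one more differentiation gives [D3]. *)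
Lemma is_diff_quasi_deriv v x : is_diff x (fun y => H y v) (fun u => D2 x u v).
Proof.
have := is_diffB (is_diff_cst v x) (is_diff_mull v (is_diff_quasi x)).
move=> dg; apply: (is_diff_implicit (fun y => quasi_derivP y v) (is_diff_id x) dg).
  by apply: smooth_diff; apply: smooth_quasi_deriv; [exact: smooth_id|exact: smooth_cst].
by move=> u; rewrite resolventP // fctE sub0r.
Qed.

Lemma is_diff_quasi_deriv2 u v x : is_diff x (fun y => D2 y u v) (fun s => D3 x s u v).
Proof.
have dg := is_diffB (is_diffN (is_diff_mull v (is_diff_quasi_deriv u x)))
  (is_diff_mull u (is_diff_quasi_deriv v x)).
apply: (is_diff_implicit (fun y => resolventP mul_nil y _) (is_diff_id x) dg).
  exact/smooth_diff/smooth_quasi_deriv2.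
by move=> s; rewrite resolventP // fctE.
Qed.

Lemma quasi_deriv2C x u v : D2 x u v = D2 x v u.
Proof. by rewrite /D2 addrC. Qed.

(** The derivative of [gamma_quasi_deriv] in [x]. Together with [quasi_deriv2C] it makes
    [gamma (D2 x u v) w] totally symmetric. *)
Lemma gamma_quasi_deriv2 x u v w : gamma (D2 x u v) w = gamma v (D2 x u w).
Proof.
have d1 := is_diff_bilinear gammaB (is_diff_quasi_deriv v x) (is_diff_cst w x).
have d2 := is_diff_bilinear gammaB (is_diff_cst v x) (is_diff_quasi_deriv w x).
have e : (fun y => gamma (H y v) w) = (fun y => gamma v (H y w)).
  by apply/funext => y; rewrite gamma_quasi_deriv.
have := is_diff_unique d1; rewrite e => /(_ _ d2)/(congr1 (fun f => f u)) /=.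
by rewrite linear0r linear0l addr0 add0r.
Qed.

Lemma quasi0 : quasi 0 = 0.
Proof. by apply/esym/(quasi_unique mul_nil); rewrite linear0l addr0. Qed.

Lemma quasi_deriv0 v : H 0 v = v.
Proof. by have := quasi_derivP 0 v; rewrite linear0l quasi0 linear0r addr0 subr0. Qed.

Lemma resolvent0 v : resolvent 0 v = v.
Proof. by have := resolventP mul_nil 0 v; rewrite linear0l addr0. Qed.

Lemma quasi_deriv20 u v : D2 0 u v = - (u ** v) *+ 2.
Proof. by rewrite /D2 resolvent0 !quasi_deriv0 (mulC v) mulr2n. Qed.

Lemma quasi_deriv30 s u v :
  D3 0 s u v = (s ** (u ** v) + u ** (s ** v) + v ** (s ** u)) *+ 2.
Proof.
rewrite /D3 resolvent0 !quasi_deriv20 !linearMnr !linearNr /= !mulNrn !opprK.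
by rewrite -!mulrnDl addrC -addrA [X in _ + X]addrC addrA.
Qed.

(* The Levi-Civita connection of a Hessian metric: half the sharp of the cubic form. *)
Definition christoffel x u v := 2^-1 *: quasi_deriv_inv x (D2 x u v).

Lemma quasi_deriv_christoffel x u v : H x (christoffel x u v) = 2^-1 *: D2 x u v.
Proof.
rewrite -[in RHS](quasi_deriv_invK x (D2 x u v)).
pose HL := GRing.isLinear.Build _ _ _ _ (H x) (@quasi_deriv_linear x).
pose HL' : {linear 'rV[R]_n -> 'rV[R]_n} := HB.pack (H x) HL.
by rewrite -[H x]/(HL' : _ -> _) linearZ.
Qed.

Lemma christoffel0 u v : christoffel 0 u v = - (u ** v).
Proof.
apply: (@quasi_deriv_inj 0); rewrite quasi_deriv_christoffel quasi_deriv0 quasi_deriv20.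
by rewrite -[X in _ *: X]scaler_nat scalerA mulVf ?scale1r // pnatr_eq0.
Qed.

(* An affine map of J under which the gradient of the potential transforms
   contragrediently, so that the potential changes by an affine function. *)
Definition motion (E E' : 'rV[R]_n -> 'rV[R]_n) b b' :=
  [/\ linear E, linear E', forall u v, gamma (E u) (E' v) = gamma u v &
      forall x, quasi (E x + b) = E' (quasi x) + b'].

(** In the hull [exp L_y] maps [1 + x] to [1 + (expL y x + expL1 y y)], because [L_y] sends the unit
    to [y]. Applying [expL (- y)] to [expL_quasi] isolates [quasi] of the image, and [expL (- y)] is
    contragredient to [expL y] because [expL y] is self-adjoint. *)
Lemma motion_expL y :
  motion (expL y) (expL (- y)) (expL1 y y) (- expL1 (- y) (- y)).
Proof.
split; [exact: expL_linear|exact: expL_linear| |] => [u v|x].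
  by rewrite gamma_expL expLK.
have := congr1 (expL (- y)) (expL_quasi y x).
by rewrite expLNK expLD => ->; rewrite -(expL_expL1 (- y)) opprK.
Qed.

Lemma motion_comp E E' b b' G G' c c' :
  motion E E' b b' -> motion G G' c c' ->
  motion (G \o E) (G' \o E') (G b + c) (G' b' + c').
Proof.
move=> [El El' EE Eq] [Gl Gl' GG Gq].
have aff L z u v : linear L -> L (u + v) + z = L u + (L v + z).
  by move=> Ll; have := Ll 1 u v; rewrite !scale1r addrA => ->.
split=> [a u v|a u v|u v|x] /=.
- by rewrite El Gl.
- by rewrite El' Gl'.
- by rewrite GG EE.
- by rewrite -aff // Gq Eq aff.
Qed.

Lemma is_diff_affine (L : 'rV[R]_n -> 'rV[R]_n) b x :
  linear L -> is_diff x (fun y => L y + b) L.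
Proof.
move=> Ll; have := is_diff_linear Ll (linear_rV_continuous Ll) (is_diff_id x).
move=> d; have := is_diffD d (is_diff_cst b x).
by move/is_diff_eq; apply; rewrite addr0.
Qed.

Section Motion.
Variables (E E' : 'rV[R]_n -> 'rV[R]_n) (b b' : 'rV[R]_n).
Hypothesis EM : motion E E' b b'.

Let El : linear E. Proof. by case: EM. Qed.
Let El' : linear E'. Proof. by case: EM. Qed.
Let Ec' := linear_rV_continuous El'.

(** The chain rule applied to [quasi (E x + b) = E' (quasi x) + b']; the rules for [D2] and [D3]
    follow by differentiating again. *)
Lemma motion_quasi_deriv x u : H (E x + b) (E u) = E' (H x u).
Proof.
have d1 := is_diff_comp (is_diff_affine b x El) (is_diff_quasi (E x + b)).
have d2 := is_diffD (is_diff_linear El' Ec' (is_diff_quasi x)) (is_diff_cst b' x).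
have e : quasi \o (fun y => E y + b) = (fun y => E' (quasi y)) + cst b'.
  by apply/funext => y /=; case: EM => _ _ _ ->.
move: d1; rewrite e => /is_diff_unique/(_ d2)/(congr1 (fun f => f u)) /= ->.
by rewrite addr0.
Qed.

Lemma motion_quasi_deriv2 x u v : D2 (E x + b) (E u) (E v) = E' (D2 x u v).
Proof.
have d1 := is_diff_comp (is_diff_affine b x El) (is_diff_quasi_deriv (E v) (E x + b)).
have d2 := is_diff_linear El' Ec' (is_diff_quasi_deriv v x).
have e : (fun y => H y (E v)) \o (fun y => E y + b) = (fun y => E' (H y v)).
  by apply/funext => y /=; rewrite motion_quasi_deriv.
by move: d1; rewrite e => /is_diff_unique/(_ d2)/(congr1 (fun f => f u)).
Qed.

Lemma motion_quasi_deriv3 x s u v :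
  D3 (E x + b) (E s) (E u) (E v) = E' (D3 x s u v).
Proof.
have d1 := is_diff_comp (is_diff_affine b x El) (is_diff_quasi_deriv2 (E u) (E v) (E x + b)).
have d2 := is_diff_linear El' Ec' (is_diff_quasi_deriv2 u v x).
have e : (fun y => D2 y (E u) (E v)) \o (fun y => E y + b) = (fun y => E' (D2 y u v)).
  by apply/funext => y /=; rewrite motion_quasi_deriv2.
by move: d1; rewrite e => /is_diff_unique/(_ d2)/(congr1 (fun f => f s)).
Qed.

Lemma motion_christoffel x u v :
  christoffel (E x + b) (E u) (E v) = E (christoffel x u v).
Proof.
apply: (@quasi_deriv_inj (E x + b)); rewrite motion_quasi_deriv.
rewrite !quasi_deriv_christoffel motion_quasi_deriv2.
pose EL := GRing.isLinear.Build _ _ _ _ E' El'.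
pose EL' : {linear 'rV[R]_n -> 'rV[R]_n} := HB.pack E' EL.
by rewrite -[E']/(EL' : _ -> _) linearZ.
Qed.

Lemma motion_potential : exists c, forall x,
  potential (E x + b) = potential x + gamma (E x) b' + c.
Proof.
exists (potential (E 0 + b) - potential 0 - gamma (E 0) b') => x.
pose f x := potential (E x + b) - potential x - gamma (E x) b'.
suff -> : potential (E 0 + b) - potential 0 - gamma (E 0) b' = f x.
  by rewrite /f; ring.
apply/esym; apply: (@is_diff0_segment R _ f 0 x) => t _; set y := 0 + _.
have d1 := is_diff_comp (is_diff_affine b y El) (is_diff_potential (E y + b)).
have d2 := is_diff_bilinear gammaB
  (is_diff_linear El (linear_rV_continuous El) (is_diff_id y)) (is_diff_cst b' y).
have := is_diffB (is_diffB d1 (is_diff_potential y)) d2.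
move/is_diff_eq; apply; apply/funext => u; rewrite !fctE /= linear0r addr0.
case: EM => _ _ EE ->; rewrite linearDr /= EE.
by ring.
Qed.

End Motion.

(** * The affine motions and their transitivity *)

Definition affine_motion (phi : 'rV[R]_n -> 'rV[R]_n) :=
  exists E E' b b', motion E E' b b' /\ phi = (fun x => E x + b).

Definition motion_pair phi psi :=
  [/\ affine_motion phi, affine_motion psi, cancel phi psi & cancel psi phi].

Lemma affine_motion_comp phi psi :
  affine_motion phi -> affine_motion psi -> affine_motion (phi \o psi).
Proof.
move=> [E [E' [b [b' [EM ->]]]]] [G [G' [c [c' [GM ->]]]]].
exists (E \o G), (E' \o G'), (E c + b), (E' c' + b'); split.
  exact: motion_comp GM EM.
apply/funext => x /=; case: EM => + _ _ _ => /(_ 1 (G x) c).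
by rewrite !scale1r => ->; rewrite addrA.
Qed.

Lemma motion_pair_comp phi psi phi' psi' :
  motion_pair phi psi -> motion_pair phi' psi' ->
  motion_pair (phi \o phi') (psi' \o psi).
Proof.
move=> [phiM psiM K K'] [phiM' psiM' L L'].
by split; [exact: affine_motion_comp|exact: affine_motion_comp|exact: can_comp..].
Qed.

Lemma motion_pairC phi psi : motion_pair phi psi -> motion_pair psi phi.
Proof. by case. Qed.

Lemma affine_motion_expL y : affine_motion (fun x => expL y x + expL1 y y).
Proof. by do 4!eexists; split; first exact: motion_expL. Qed.

Lemma motion_pair_expL y :
  motion_pair (fun x => expL y x + expL1 y y) (fun x => expL (- y) x + expL1 (- y) (- y)).
Proof.
split; [exact: affine_motion_expL|exact: affine_motion_expL| |] => x.
  have := expL_expL1 (- y); rewrite opprK => e.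
  by rewrite expLD expLNK e subrK.
by rewrite expLD expLK expL_expL1 subrK.
Qed.

Lemma motion_pair_id : motion_pair id id.
Proof.
have iM : affine_motion id.
  have -> : id = (fun x => expL 0 x + expL1 0 0).
    by apply/funext => x; rewrite expL0 expL1_0 addr0.
  exact: affine_motion_expL.
by split.
Qed.

(* The motion [exp (- L_v)] sends [v] to a combination of higher powers; iterating
   reaches [0] because the algebra is nilpotent. *)
Lemma motion_transitive x : exists phi psi, motion_pair phi psi /\ phi 0 = x.
Proof.
suff step k v : power_ideal mul x (m - k) v ->
    exists phi psi, motion_pair phi psi /\ phi 0 = v.
  (* Level [0] contains [x] itself, its own first power. *)
  by apply: (step m); rewrite subnn; exact: (@power_ideal_pow _ _ mul x 0 0).
elim: k v => [|k IH] v; first rewrite subn0.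
  move=> /(power_ideal_nil mul_nil) ->; exists id, id; split=> //.
  exact: motion_pair_id.
move=> vI; have [mk|km] := leqP m k.
  (* The subtraction is truncated: both levels are [0]. *)
  have /eqP e1 : (m - k == 0)%N by rewrite subn_eq0.
  have /eqP e2 : (m - k.+1 == 0)%N by rewrite subn_eq0 leqW.
  by apply: IH; rewrite e1 -e2.
pose v' := expL (- v) v + expL1 (- v) (- v).
have [phi [psi [pM phi0]]] : exists phi psi, motion_pair phi psi /\ phi 0 = v'.
  apply: IH; rewrite /v' /expL /expL1 -big_split; apply: power_ideal_sum => i /=.
  have -> : iter i (mul (- v)) (- v) = - iter i (mul (- v)) v.
    by rewrite -[X in iter i _ X = _]scaleN1r iter_mulZ scaleN1r.
  (* Term [i] of [v'] has the coefficient [1/i! - 1/(i+1)!], which is zero for [i = 0]; all other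
     terms contain a product with [v] and so lie at a deeper level. *)
  rewrite scalerN -scalerBl; case: i => -[|i] im /=.
    by rewrite invr1 subrr scale0r; exact: power_ideal0.
  apply: power_idealZ; elim: i {im} => [|i IHi] /=.
    rewrite linearNl -scaleN1r; apply: power_idealZ.
    apply: power_ideal_le (power_ideal_mul mulC jordan vI vI).
    by rewrite -(subnSK km) ltnS leq_addr.
  rewrite linearNl -scaleN1r; apply: power_idealZ.
  apply: power_ideal_le (power_ideal_mul mulC jordan vI IHi).
  by rewrite leqW // leq_addl.
exists ((fun x => expL v x + expL1 v v) \o phi).
exists (psi \o (fun x => expL (- v) x + expL1 (- v) (- v))).
split; first by apply: motion_pair_comp => //; exact: motion_pair_expL.
by case: (motion_pair_expL v) => _ _ _ K; rewrite /= phi0 /v' K.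
Qed.

Lemma derive_is_diff (V W : normedModType R) (f df : V -> W) (p e : V) :
  is_diff p f df -> 'D_e f p = df e.
Proof. by move=> fd; rewrite deriveE ?diff_val //; exact: ex_diff. Qed.

Lemma derive1_is_diff (W : normedModType R) (c : R -> W) t (dc : W) :
  is_diff t c ( *:%R^~ dc) -> derive1 c t = dc.
Proof. by move=> cd; rewrite derive1E (derive_is_diff _ cd) scale1r. Qed.

(** * Induced structure and Levi-Civita connection of the graph *)

Local Notation f := (graph_map potential).
Local Notation xi := ((0, 1) : 'rV[R]_n * R).

Definition affine_metric x u v : R := gamma (H x u) v.
Local Notation h := affine_metric.

(** Since [xi] is vertical and constant, projection to the base turns the induced connection into
    the standard flat one, with zero Christoffel symbols. *)
Definition flat_connection x u v : 'rV[R]_n := 0.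
Local Notation nabla := flat_connection.

Lemma is_diff_graph x : is_diff x f (fun u => (u, gamma u (quasi x))).
Proof. exact: (is_diff_pair (is_diff_id x) (is_diff_potential x)). Qed.

Lemma diff_graph x u : 'd f x u = (u, gamma u (quasi x)).
Proof. by have d := is_diff_graph x; rewrite diff_val. Qed.

Lemma transversal_graph : transversal_field f xi.
Proof.
by move=> x [u _]; rewrite diff_graph => -[-> /eqP]; rewrite linear0l eq_sym oner_eq0.
Qed.

Lemma induced_structure_graph : induced_structure f xi nabla h.
Proof.
split.
  split=> [x|u v].
    by split=> w a u v; exact: esym (etrans (addr0 _) (scaler0 _ _)).
  exact: smooth_cst.
move=> X Y Xs Ys x.
have Yd : is_diff x Y ('d Y x) by apply/differentiableP; exact: smooth_diff.
pose Z := 'D_(X x) Y x.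
have ZE : Z = 'd Y x (X x) by exact: derive_is_diff.
have d := is_diff_pair Yd (is_diff_bilinear gammaB Yd (is_diff_quasi x)).
(* By the product rule the first summand completes [Z] to a tangent vector, and the second is the
   component [h] along [xi]. *)
transitivity (Z, gamma Z (quasi x) + gamma (Y x) (H x (X x))).
  have -> : (fun y => 'd f y (Y y)) = fun y => (Y y, gamma (Y y) (quasi y)).
    by apply/funext => y; exact: diff_graph.
  by rewrite ZE; exact: (derive_is_diff (X x) d).
have cvE : covariant_derivative nabla X Y x = Z by exact: addr0.
rewrite cvE.
transitivity ((Z, gamma Z (quasi x)) + h x (X x) (Y x) *: xi); last first.
  by congr (_ + _); rewrite -diff_graph.
congr pair; first by apply/esym/eqP; rewrite /= scaler0 addr0.
by congr (_ + _); rewrite gammaC; apply/esym; exact: mulr1.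
Qed.

Lemma christoffelC x u v : christoffel x u v = christoffel x v u.
Proof. by rewrite /christoffel quasi_deriv2C. Qed.

Lemma quasi_deriv2_linear x u : linear (D2 x u).
Proof.
move=> a v w; rewrite /D2 -resolvent_linear; congr (resolvent x _).
rewrite (quasi_deriv_linear x) linearPl linearPr scalerBr scalerN !opprD.
by rewrite -!addrA; congr (_ + _); rewrite addrCA.
Qed.

Lemma quasi_deriv_inv_linear x : linear (quasi_deriv_inv x).
Proof.
move=> a v w; rewrite /quasi_deriv_inv -resolvent_linear; congr (resolvent _ _).
by rewrite linearPr scalerDr -!addrA; congr (_ + _); rewrite addrCA.
Qed.

Lemma christoffel_linear x u : linear (christoffel x u).
Proof.
move=> a v w; rewrite /christoffel (quasi_deriv2_linear x u) (quasi_deriv_inv_linear x).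
by rewrite scalerDr !scalerA [a * _]mulrC.
Qed.

Lemma smooth_christoffel u v : smooth_on setT (fun x => christoffel x u v).
Proof.
apply: smooth_linear => [a w w'|]; first by rewrite scalerDr !scalerA mulrC.
apply: smooth_resolvent; first exact/smoothN/smooth_quasi.
apply: smoothD; first exact: smooth_quasi_deriv2.
by apply: smooth_mul; [exact: smooth_id|exact: smooth_quasi_deriv2].
Qed.

Lemma is_diff_affine_metric v w x :
  is_diff x (fun y => h y v w) (fun u => gamma (D2 x u v) w).
Proof.
have := is_diff_bilinear gammaB (is_diff_quasi_deriv v x) (is_diff_cst w x).
by move/is_diff_eq; apply; apply/funext => u; rewrite linear0r addr0.
Qed.

Lemma levi_civita_christoffel : levi_civita h christoffel.
Proof.
split.
- split=> [x|u v]; last exact: smooth_christoffel.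
  by split=> u a v w; rewrite ?[christoffel x _ u]christoffelC christoffel_linear //
    !(christoffelC x u).
- exact: christoffelC.
- move=> x u v w; rewrite /covariant_derivative2 (derive_is_diff _ (is_diff_affine_metric v w x)).
  (* By the symmetries of [H] and [D2] each connection term is half of the cubic form. *)
  rewrite /h quasi_deriv_christoffel gamma_quasi_deriv quasi_deriv_christoffel.
  rewrite linearZl linearZr /= -gamma_quasi_deriv2; by field.
Qed.

Lemma quasi_deriv_v0 x : H x 0 = 0.
Proof.
apply: (one_plus_mul_inj mul_nil (x := x)).
by rewrite quasi_derivP linear0l linear0r subr0 addr0.
Qed.

Lemma non_degenerate_affine_metric : non_degenerate h.
Proof.
move=> x u hu; apply: (@quasi_deriv_inj x); rewrite quasi_deriv_v0.
exact: gamma_nd.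
Qed.

Lemma cubic_formE x u v w : covariant_derivative2 nabla h x u v w = gamma (D2 x u v) w.
Proof.
rewrite /covariant_derivative2 (derive_is_diff _ (is_diff_affine_metric v w x)).
by rewrite /flat_connection /h quasi_deriv_v0 linear0l linear0r !subr0.
Qed.

(** An affine map with a right inverse has a surjective linear part; tangent vectors at any point
    can thus be pulled back to [0]. *)
Lemma linear_surj E E' b b' psi : motion E E' b b' ->
  cancel psi (fun x => E x + b) -> forall u, exists u', u = E u'.
Proof. by move=> _ K u; exists (psi (u + b)); rewrite -[LHS](addrK b) -{1}(K (u + b)) addrK. Qed.

Lemma parallel_cubic_form_christoffel : parallel_cubic_form nabla h christoffel.
Proof.
move=> x s u v w; rewrite /covariant_derivative3.
have -> : covariant_derivative2 nabla h = fun y u v w => gamma (D2 y u v) w.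
  by do 4!(apply/funext => ?); rewrite cubic_formE.
have d := is_diff_bilinear gammaB (is_diff_quasi_deriv2 u v x) (is_diff_cst w x).
rewrite (derive_is_diff _ d) linear0r addr0.
have [phi [psi [[phiM _ _ K] phi0]]] := motion_transitive x.
have [E [E' [b [b' [EM phiE]]]]] := phiM; rewrite phiE in K phi0.
have [s' ->] := linear_surj EM K s; have [u' ->] := linear_surj EM K u.
have [v' ->] := linear_surj EM K v; have [w' ->] := linear_surj EM K w.
rewrite -phi0 !(motion_christoffel EM) !(motion_quasi_deriv2 EM) (motion_quasi_deriv3 EM).
have EE p q : gamma (E' p) (E q) = gamma p q.
  by case: EM => _ _ EE _; rewrite gammaC EE gammaC.
(* At [0] the cubic form is [- 2 gamma(u v, w)] and the Christoffel symbol is [- u v]: the three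
   connection terms cancel the three summands of [D3]. *)
rewrite !EE !christoffel0 !quasi_deriv20 quasi_deriv30.
rewrite !linearMnl !linearDl !linearNl !linearNr /= ?linearNl /= !mulNrn !opprK.
rewrite -gammaA (mulC (u' ** v') s') (mulC (s' ** u') v').
by ring.
Qed.

(** * Isometries, point reflections and geodesics *)

Lemma metric_isometry_comp phi phi' : metric_isometry h phi -> metric_isometry h phi' ->
  metric_isometry h (phi \o phi').
Proof.
move=> [psi [[K L] phis psis phih]] [psi' [[K' L'] phis' psis' phih']].
exists (psi' \o psi); split.
- by split; exact: can_comp.
- by move=> k; exact: (Ck_on_comp openT (phis' k) (phis k)).
- by move=> k; exact: (Ck_on_comp openT (psis k) (psis' k)).
- move=> x u v; rewrite !(diff_comp (smooth_diff _ phis') (smooth_diff _ phis)) /=.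
  by rewrite phih phih'.
Qed.

Lemma smooth_affine_motion phi : affine_motion phi -> smooth_on setT phi.
Proof.
move=> [E [E' [b [b' [EM ->]]]]]; apply: smoothD; last exact: smooth_cst.
by case: EM => El _ _ _; apply: smooth_linear => //; exact: smooth_id.
Qed.

Lemma motion_isometry phi psi : motion_pair phi psi -> metric_isometry h phi.
Proof.
move=> [phiM psiM K L]; exists psi; split; [by split|exact: smooth_affine_motion..|].
move=> x u v; case: phiM => [E [E' [b [b' [EM ->]]]]].
have d : is_diff x (fun x => E x + b) E by case: EM => El _ _ _; exact: is_diff_affine.
rewrite !diff_val /h (motion_quasi_deriv EM) gammaC.
by case: EM => _ _ -> _; rewrite gammaC.
Qed.

Lemma is_diff_reflection x : is_diff x (fun y => - quasi y) (fun u => - H x u).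
Proof. exact: (is_diffN (is_diff_quasi x)). Qed.

(** The chain rule for the involution [quasiK]: [H] at the reflected point inverts [H x], which is
    what makes the reflection an isometry. *)
Lemma quasi_deriv_reflection x u : H (- quasi x) (H x u) = u.
Proof.
have := is_diff_comp (is_diff_reflection x) (is_diff_reflection (- quasi x)).
have -> : (fun y => - quasi y) \o (fun y => - quasi y) = id.
  by apply/funext => y; rewrite /= quasiK.
move=> /is_diff_unique/(_ (is_diff_id x))/(congr1 (fun l => l u)) /=.
by rewrite -scaleN1r -[- H x u]addr0 -[in H _ _](scaleN1r (H x u)) quasi_deriv_linear
  quasi_deriv_v0 addr0 scalerA mulN1r opprK scale1r.
Qed.

Lemma reflection_isometry : metric_isometry h (fun x => - quasi x).
Proof.
have s : smooth_on setT (fun x => - quasi x) by exact/smoothN/smooth_quasi.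
have K : cancel (fun x => - quasi x) (fun x => - quasi x) by exact: quasiK.
exists (fun x => - quasi x); split=> // x u v.
have d := is_diff_reflection x; rewrite !diff_val /h linearNr /= gamma_quasi_deriv.
by rewrite linearNl opprK gammaC quasi_deriv_reflection gammaC.
Qed.

Lemma symmetric_affine_metric : symmetric_space h.
Proof.
move=> x; have [phi [psi [pM phi0]]] := motion_transitive x.
have psix : psi x = 0 by case: pM => _ _ K _; rewrite -phi0 K.
(* The reflection at [0] carried to [x] by a motion; conjugation preserves the differential
   [- id]. *)
pose s := phi \o (fun y => - quasi y) \o psi; exists s; split.
- apply: metric_isometry_comp (motion_isometry (motion_pairC pM)).
  exact: metric_isometry_comp (motion_isometry pM) reflection_isometry.
- by rewrite /s /= psix quasi0 oppr0.
- have [[E [E' [b [b' [EM phiE]]]]] [G [G' [c [c' [GM psiE]]]]] K L] := pM.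
  have El : linear E by case: EM.
  have Gl : linear G by case: GM.
  have Gd : is_diff x psi G by rewrite psiE; exact: is_diff_affine.
  have Ed y : is_diff y phi E by rewrite phiE; exact: is_diff_affine.
  have EG : E \o G = id.
    have := is_diff_comp Gd (Ed (psi x)).
    have -> : phi \o psi = id by apply/funext => y; exact: L.
    by move=> /is_diff_unique/(_ (is_diff_id x)).
  have sd : is_diff x s (fun u => E (- H (psi x) (G u))).
    exact: (is_diff_comp Gd (is_diff_comp (is_diff_reflection (psi x)) (Ed _))).
  move=> u; rewrite diff_val psix quasi_deriv0 (linear_funN _ El).
  by rewrite -[E (G u)]/((E \o G) u) EG.
Qed.

Lemma geodesically_complete_christoffel : geodesically_complete christoffel.
Proof.
move=> x u; have [phi [psi [pM phi0]]] := motion_transitive x.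
have [[E [E' [b [b' [EM phiE]]]]] _ _ L] := pM; rewrite phiE in L phi0.
have [u0 ->] := linear_surj EM L u.
have El : linear E by case: EM.
have Ed (c : R -> 'rV[R]_n) t w : is_diff t c ( *:%R^~ w) ->
    is_diff t (fun t => E (c t)) ( *:%R^~ (E w)).
  move=> /(is_diff_linear El (linear_rV_continuous El))/is_diff_eq; apply.
  pose EL := GRing.isLinear.Build _ _ _ _ E El.
  pose EL' : {linear 'rV[R]_n -> 'rV[R]_n} := HB.pack E EL.
  by apply/funext => s; rewrite -[E]/(EL' : _ -> _) linearZ.
pose c0 t := expL1 (t *: u0) (t *: u0).
pose c t := E (c0 t) + b.
have cd t : is_diff t c ( *:%R^~ (E (expL (t *: u0) u0))).
  have := is_diffD (Ed _ _ _ (is_diff_expL1 u0 t)) (is_diff_cst b t).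
  by move/is_diff_eq; apply; rewrite addr0.
have c1 : derive1 c = fun t => E (expL (t *: u0) u0).
  by apply/funext => t; exact: derive1_is_diff (cd t).
have c1d t : is_diff t (derive1 c) ( *:%R^~ (E (expL (t *: u0) (u0 ** u0)))).
  rewrite c1; apply: Ed.
  have zd : is_diff t (fun=> u0) ( *:%R^~ (0 : 'rV[R]_n)).
    by apply: is_diff_eq; apply/funext => s; rewrite scaler0.
  by have := is_diff_expL u0 zd; rewrite addr0.
exists c; split=> [t||].
- split; first exact/derivable1_diffP/ex_diff.
    exact/derivable1_diffP/ex_diff.
  rewrite (derive1_is_diff (c1d t)) c1 /c (motion_christoffel EM).
  (* The point [c0 t] is the image of [0] under the motion of [t u0], and the velocity is the image
     of [u0]. The Christoffel term is therefore the image of [- (u0 u0)], which cancels the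
     acceleration. *)
  have -> : c0 t = expL (t *: u0) 0 + c0 t by rewrite expL0v add0r.
  rewrite (motion_christoffel (motion_expL (t *: u0))) christoffel0 expLN.
  rewrite (linear_funN _ El).
  exact: subrr.
- by rewrite /c /c0 !scale0r expL1_0.
- by rewrite c1 scale0r expL0.
Qed.

(** * Affine transformations preserving the graph *)

Definition graph_motion A phi :=
  [/\ affine_transformation A, metric_isometry h phi & A \o f = f \o phi].

Lemma graph_motion_comp A A' phi phi' : graph_motion A phi -> graph_motion A' phi' ->
  graph_motion (A \o A') (phi \o phi').
Proof.
move=> [[Ab [L1 [b1 A1]]] p1 e1] [[Ab' [L2 [b2 A2]]] p2 e2]; split.
- split; first exact: bij_comp.
  by exists (L1 \o L2), (L1 b2 + b1) => p; rewrite /= A2 A1 linearD addrA.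
- exact: metric_isometry_comp.
- have e x : A (f x) = f (phi x) := congr1 (fun g => g x) e1.
  have e' x : A' (f x) = f (phi' x) := congr1 (fun g => g x) e2.
  by apply/funext => x; rewrite /= e' e.
Qed.

Definition graph_motion_pair A B := exists phi psi,
  [/\ graph_motion A phi, graph_motion B psi, cancel A B & cancel B A].

Lemma motion_graph phi psi : motion_pair phi psi ->
  exists A B, [/\ graph_motion A phi, graph_motion B psi, cancel A B & cancel B A].
Proof.
move=> pM; have [phiM psiM K L] := pM.
have [E [E' [b [b' [EM phiE]]]]] := phiM; have [G [G' [c [c' [GM psiE]]]]] := psiM.
have [k kE] := motion_potential EM; have [l lE] := motion_potential GM.
(* The vertical shift is the affine change of the potential from [motion_potential], so that [A]
   preserves the graph. *)
pose A (p : 'rV[R]_n * R) := (phi p.1, p.2 + gamma (E p.1) b' + k).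
pose B (p : 'rV[R]_n * R) := (psi p.1, p.2 + gamma (G p.1) c' + l).
have Af x : A (f x) = f (phi x) by rewrite /A /graph_map /= phiE kE.
have Bf x : B (f x) = f (psi x) by rewrite /B /graph_map /= psiE lE.
(* [A] and [B] shift the second coordinate by a function of the first, so it suffices to compute
   their composites on the graph. *)
have shift (S T : 'rV[R]_n * R -> 'rV[R]_n * R) (p : 'rV[R]_n * R) :
    (S (T (f p.1)) = f p.1) -> (S (T p)).1 = (S (T (f p.1))).1 ->
    (S (T p)).2 - p.2 = (S (T (f p.1))).2 - potential p.1 -> S (T p) = p.
  move=> e; rewrite e /= subrr => e1 /eqP; rewrite subr_eq0 => /eqP e2.
  by rewrite [LHS]surjective_pairing e1 e2 -surjective_pairing.
have AB : cancel A B.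
  by move=> p; apply: shift => //; [rewrite Af Bf K|rewrite /A /B /=; ring].
have BA : cancel B A.
  by move=> p; apply: shift => //; [rewrite Bf Af L|rewrite /A /B /=; ring].
have aff (M : 'rV[R]_n -> 'rV[R]_n) (d d' : 'rV[R]_n) (a : R) (S T : 'rV[R]_n * R -> 'rV[R]_n * R) :
    linear M -> (forall p, S p = (M p.1 + d, p.2 + gamma (M p.1) d' + a)) ->
    cancel S T -> cancel T S -> affine_transformation S.
  move=> Ml SE ST TS; split; first by exists T.
  pose L0 (p : 'rV[R]_n * R) := (M p.1, p.2 + gamma (M p.1) d').
  have L0l : linear L0.
    move=> r p q; rewrite /L0 /= Ml linearPl; congr pair.
    transitivity (r * (p.2 + gamma (M p.1) d') + (q.2 + gamma (M q.1) d')) => //.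
    by rewrite mulrDr addrACA.
  pose LM := GRing.isLinear.Build _ _ _ _ L0 L0l.
  pose LL : {linear ('rV[R]_n * R)%type -> ('rV[R]_n * R)%type} := HB.pack L0 LM.
  by exists LL, (d, a) => p; rewrite SE.
exists A, B; split=> //; split.
- apply: (aff E b b' k A B) => // [|p]; first by case: EM.
  by rewrite /A phiE.
- exact: motion_isometry pM.
- exact/funext.
- apply: (aff G c c' l B A) => // [|p]; first by case: GM.
  by rewrite /B psiE.
- exact: motion_isometry (motion_pairC pM).
- exact/funext.
Qed.

Lemma homogeneous_graph : homogeneous f h.
Proof.
(* All affine maps that, like their inverses, restrict to isometries of the graph: the group axioms
   are then formal, and the motions supply transitivity. *)
exists [set A | exists B, graph_motion_pair A B]; split.
- split.
  + by move=> A [B [phi [psi [[]]]]].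
  + have [A [B [AM BM _ _]]] := motion_graph motion_pair_id.
    have idM : graph_motion id id.
      split=> //; last exact: motion_isometry motion_pair_id.
      by split; [exists id|exists idfun, 0 => p; rewrite addr0].
    by exists id, id, id.
  + move=> A A' [B [phi [psi [aM bM K L]]]] [B' [phi' [psi' [aM' bM' K' L']]]].
    exists (B' \o B), (phi \o phi'), (psi' \o psi).
    by split; [exact: graph_motion_comp|exact: graph_motion_comp|exact: can_comp..].
  + by move=> A [B [phi [psi [aM bM K L]]]]; exists B => //; exists A, psi, phi.
- by move=> A [B [phi [psi [[_ aM e] _ _ _]]]]; exists phi.
move=> _ _ [x _ <-] [y _ <-].
have [phi [psi [pM phi0]]] := motion_transitive x.
have [phi' [psi' [pM' phi0']]] := motion_transitive y.
have [A [B [aM bM K L]]] := motion_graph (motion_pair_comp pM' (motion_pairC pM)).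
exists A; first by exists B, (phi' \o psi), (phi \o psi').
case: aM => _ _ e; rewrite -[A (f x)]/((A \o f) x) e /=.
by case: pM => _ _ K' _; rewrite -phi0 K' phi0'.
Qed.

(** * The volume condition *)

Lemma det_one_plus_mul y : \det (1%:M + lin1_mx (mul y)) = 1.
Proof.
apply: (@det_unipotent _ _ _ m); apply/row_matrixP => i.
have rE k : row i (iter k (fun A => A *m lin1_mx (mul y)) 1%:M) = iter k (mul y) (row i 1%:M).
  by elim: k => //= k IH; rewrite row_mul IH mul_rV_lin1.
by rewrite rE mul_nil row0.
Qed.

Lemma improper_affine_hypersphere_graph : `|\det (form_matrix gamma)| = 1 ->
  improper_affine_hypersphere f xi h.
Proof.
move=> dg; split=> [|x X]; first exact: non_degenerate_affine_metric.
pose HL := GRing.isLinear.Build _ _ _ _ (H x) (@quasi_deriv_linear x).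
pose HL' : {linear 'rV[R]_n -> 'rV[R]_n} := HB.pack (H x) HL.
pose HM := lin1_mx HL'.
have dH : \det HM = 1.
  (* [H x] followed by [1 + L_x] is [1 - L_(quasi x)], and the last two operators are unipotent. *)
  have : HM *m (1%:M + lin1_mx (mul x)) = 1%:M + lin1_mx (mul (- quasi x)).
    apply/row_matrixP => i; rewrite !rowE mulmxA !mulmxDr !mulmx1 !mul_rV_lin1.
    pose w : 'rV[R]_n := 'e_i; transitivity (w + - quasi x ** w) => //.
    by rewrite -[LHS]/(H x w + x ** H x w) quasi_derivP (mulC w) linearNl.
  by move=> /(congr1 determinant); rewrite det_mulmx !det_one_plus_mul mulr1.
pose U := \matrix_(i, j) X i 0 j.
have rU i : row i U = X i by apply/rowP => j; rewrite !mxE.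
have -> : \matrix_(i, j) h x (X i) (X j) = U *m HM *m form_matrix gamma *m U^T.
  apply/matrixP => i j; rewrite mxE /h biscalar_mxE -[H x _](mul_rV_lin1 HL') -!rU.
  rewrite -!row_mul [LHS]mxE [LHS]mxE [RHS]mxE; apply: eq_bigr => k _.
  by congr (_ * _); rewrite !mxE.
have -> : \matrix_(i, j) ('d f x (X i)).1 0 j = U.
  by apply/matrixP => i j; rewrite !mxE diff_graph.
(* Since [xi.1 = 0] the bordered matrix has determinant [det U], while the Gram matrix has
   [(det U)^2 det gamma]. *)
rewrite /= det_ublock det_scalar1 mulr1 !det_mulmx dH mulr1 det_tr mulrAC normrM dg mulr1.
by rewrite -expr2 normrX sqrtr_sqr normr_id.
Qed.

End MetrisedJordan.

(** * Euclidean completeness of graphs *)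

Lemma continuous_pair (T U V : topologicalType) (f : T -> U) (g : T -> V) (x : T) :
  {for x, continuous f} -> {for x, continuous g} ->
  {for x, continuous (fun y => (f y, g y))}.
Proof. by move=> fc gc; exact: (cvg_pair fc gc). Qed.

Section EuclideanCompleteness.
Context {R : realType} {n : nat}.
Implicit Types (g : 'rV[R]_n * R -> 'rV[R]_n * R -> R) (w : 'rV[R]_n * R).

(** Riesz representation of the coordinate forms, by inverting the Gram matrix of [g] on row vectors
    of length [n + 1]. The representing vectors let [g]-lengths control the coordinates of base
    points. *)
Lemma linear_form_representative g : euclidean_metric g ->
  forall j : 'I_n, exists e, forall w, w.1 0 j = g e w.
Proof.
move=> [gb gC gpos] j.
pose iota (z : 'rV[R]_(n + 1)) : 'rV[R]_n * R := (lsubmx z, rsubmx z 0 0).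
have iotal : linear iota.
  by move=> a u v; rewrite /iota; congr pair; [apply/rowP => i|]; rewrite !mxE.
pose g' u v := g (iota u) (iota v).
have g'b : bilinear_for *%R *%R g'.
  by split=> u a v w; rewrite /g' iotal; [exact: gb.1|exact: gb.2].
pose gm := bilinear_isBilinear.Build _ _ _ _ _ _ g' g'b.
pose gB : {bilinear 'rV[R]_(n + 1) -> 'rV[R]_(n + 1) -> R | *%R & *%R} := HB.pack g' gm.
pose G := form_matrix g'.
have g'E u v : g' u v = (u *m G *m v^T) 0 0 by exact: (biscalar_mxE gB).
have Gu : G \in unitmx.
  rewrite -row_free_unit; apply: inj_row_free => u uG0.
  have : g' u u = 0 by rewrite g'E uG0 mul0mx mxE.
  have [//|un0] := eqVneq u 0; rewrite /g' => /eqP; rewrite gt_eqF //.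
  apply: gpos; apply: contra_neq un0 => /eqP; rewrite xpair_eqE => /andP[/eqP u1 /eqP u2].
  rewrite -[u]hsubmxK u1; have -> : rsubmx u = 0 by apply/rowP => i; rewrite ord1 u2 mxE.
  by rewrite row_mx0.
exists (iota (delta_mx 0 (lshift 1 j) *m invmx G)) => w.
pose z : 'rV[R]_(n + 1) := row_mx w.1 (w.2)%:M.
have -> : w = iota z.
  by rewrite /iota /z row_mxKl row_mxKr mxE -surjective_pairing.
by rewrite -[RHS]/(g' _ _) g'E mulmxKV // -rowE !mxE.
Qed.

Lemma cauchy_schwarz g : euclidean_metric g ->
  forall v w, `|g v w| <= Num.sqrt (g v v) * Num.sqrt (g w w).
Proof.
move=> [gb gC gpos] v w.
have gge0 u : 0 <= g u u.
  have [->|/gpos/ltW //] := eqVneq u 0.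
  by have := gb.1 0 (-1) 0 0; rewrite scaler0 addr0 /= => h; move: h; lra.
rewrite -sqrtrM // -sqrtr_sqr ler_sqrt ?mulr_ge0 //.
have gr u : linear_for *%R (g u) by exact: gb.2.
have gl u : linear_for *%R (g^~ u) by exact: gb.1.
have e (t : R) : g (t *: v + w) (t *: v + w) = t ^+ 2 * g v v + 2 * t * g v w + g w w.
  by rewrite (gr (t *: v + w)) !gl (gC w v) /=; ring.
have [v0|/gpos gv] := eqVneq v 0.
  have h u : g 0 u = 0 by have := gl u (-1) 0 0; rewrite scaler0 addr0 /= => h; lra.
  by rewrite v0 !h expr0n mul0r.
(* The minimum over [t], multiplied by [g v v], is the Gram determinant. *)
have := gge0 ((- (g v w) / g v v) *: v + w); rewrite e.
rewrite -(@pmulr_rge0 _ (g v v)) //.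
have -> : g v v * ((- g v w / g v v) ^+ 2 * g v v + 2 * (- g v w / g v v) * g v w + g w w) =
    g v v * g w w - g v w ^+ 2 by field; rewrite gt_eqF.
by rewrite subr_ge0.
Qed.

Lemma quadratic_continuous g : euclidean_metric g -> continuous (fun w => g w w).
Proof.
move=> [gb gC _].
have inl : linear (fun v : 'rV[R]_n => (v, 0) : 'rV[R]_n * R).
  by move=> a u v; congr pair; exact: esym (etrans (addr0 _) (mulr0 a)).
have gr u : linear_for *%R (g u) by exact: gb.2.
have gl u : linear_for *%R (g^~ u) by exact: gb.1.
have Bb : bilinear_for *:%R *:%R (fun u v : 'rV[R]_n => g (u, 0) (v, 0) : R).
  by split=> u a v w; rewrite (inl a v w); [exact: gl|exact: gr].
have Bc := (continuous_bilinear_rV Bb).2.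
have Ll : linear (fun v : 'rV[R]_n => g (v, 0) (0, 1) : R).
  by move=> a v w; rewrite (inl a v w); exact: gl.
have Lc := linear_rV_continuous Ll.
have -> : (fun w => g w w) = (fun w => g (w.1, 0) (w.1, 0) + 2 * w.2 * g (w.1, 0) (0, 1)
    + w.2 ^+ 2 * g (0, 1) (0, 1)).
  apply/funext => -[v a] /=.
  have e : (v, a) = a *: ((0, 1) : 'rV[R]_n * R) + (v, 0).
    congr pair; last exact: esym (etrans (addr0 _) (mulr1 a)).
    exact: esym (etrans (congr1 (+%R^~ v) (scaler0 _ a)) (add0r v)).
  by rewrite {1}e gl {1}e gr {1}e gr (gC (0, 1) (v, 0)) /=; ring.
move=> w.
have c1 : {for w, continuous (fun w : 'rV[R]_n * R => w.1)} by exact: cvg_fst.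
have c2 : {for w, continuous (fun w : 'rV[R]_n * R => w.2)} by exact: cvg_snd.
have cB : {for w, continuous (fun w : 'rV[R]_n * R => g (w.1, 0) (w.1, 0))}.
  by apply: (@continuous_comp _ _ _ (fun w => (w.1, w.1)) (fun p => g (p.1, 0) (p.2, 0)));
     [exact: continuous_pair|exact: Bc].
have cL : {for w, continuous (fun w : 'rV[R]_n * R => g (w.1, 0) (0, 1))}.
  by apply: (@continuous_comp _ _ _ (fun w => w.1) (fun v => g (v, 0) (0, 1)));
     [exact: c1|exact: Lc].
apply: cvgD; first apply: cvgD; first exact: cB.
  apply: cvgM; last exact: cL.
  by apply: cvgM; [exact: cvg_cst|exact: c2].
by apply: cvgM; [exact: (cvgM c2 c2)|exact: cvg_cst].
Qed.

Variable F : 'rV[R]_n -> R.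
Hypothesis Fs : smooth_on setT F.
Local Notation f := (graph_map F).

Lemma smooth_graph_map : smooth_on setT f.
Proof.
by move=> k; apply: (Ck_on_pair openT); [apply: Ck_on_linear => // x; exact: cvg_id|exact: Fs].
Qed.

(** * Lengths of curves and the induced distance *)

Section Length.
Variable g : 'rV[R]_n * R -> 'rV[R]_n * R -> R.
Hypothesis gE : euclidean_metric g.

Let gge0 u : 0 <= g u u.
Proof.
case: gE => gb gC gpos; have [->|/gpos/ltW //] := eqVneq u 0.
by have := gb.1 0 (-1) 0 0; rewrite scaler0 addr0 /= => h; move: h; lra.
Qed.

Definition speed (c : R -> 'rV[R]_n) (t : R) :=
  Num.sqrt (g (derive1 (f \o c) t) (derive1 (f \o c) t)).

Section Curve.
Variable c : R -> 'rV[R]_n.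
Hypothesis cs : smooth_on setT c.

Lemma is_diff_graph_curve t :
  is_diff t (f \o c) (fun s => ('d c t s, 'd F (c t) ('d c t s))).
Proof.
have cd : is_diff t c ('d c t) by apply/differentiableP; have [+ _] := cs 1; apply.
have Fd : is_diff (c t) F ('d F (c t)) by apply/differentiableP; have [+ _] := Fs 1; apply.
exact: is_diff_pair cd (is_diff_comp cd Fd).
Qed.

Lemma derive1_graph_curve t :
  derive1 (f \o c) t = ('d c t 1, 'd F (c t) ('d c t 1)).
Proof.
have d := is_diff_graph_curve t.
by rewrite derive1E' ?diff_val //; exact: ex_diff.
Qed.

Lemma derive1_graph_curve_continuous : continuous (derive1 (f \o c)).
Proof.
have : Ck_on 1 setT (f \o c) by exact: (Ck_on_comp openT (cs 1) (smooth_graph_map 1)).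
move=> [_ /(_ 1) dc].
have -> : derive1 (f \o c) = fun t => 'd (f \o c) t 1.
  by apply/funext => t; have d := is_diff_graph_curve t; rewrite derive1E' //; exact: ex_diff.
by move=> t; exact: dc.
Qed.

Lemma speed_continuous : continuous (speed c).
Proof.
move=> t; apply: (@continuous_comp _ _ _ (derive1 (f \o c)) (fun w => Num.sqrt (g w w))).
  exact: derive1_graph_curve_continuous.
apply: (@continuous_comp _ _ _ (fun w => g w w) Num.sqrt).
  exact: quadratic_continuous.
exact: sqrt_continuous.
Qed.

Lemma continuous_integrable01 (u : R -> R) : continuous u ->
  lebesgue_measure.-integrable `[0, 1] (EFin \o u).
Proof.
move=> uc; apply: continuous_compact_integrable; first exact: segment_compact.
exact: continuous_subspaceT.
Qed.

Lemma curve_length_ge0 : 0 <= curve_length g f c.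
Proof. by apply: Rintegral_ge0 => t _; exact: sqrtr_ge0. Qed.

(** The fundamental theorem of calculus for the [j]-th coordinate, whose derivative is [g e] of the
    velocity, followed by Cauchy-Schwarz. *)
Lemma curve_length_ge e (j : 'I_n) : (forall w, w.1 0 j = g e w) ->
  `|c 1 0 j - c 0 0 j| <= Num.sqrt (g e e) * curve_length g f c.
Proof.
move=> ge; pose u t := c t 0 j; pose u' t := g e (derive1 (f \o c) t).
have cl : linear (fun v : 'rV[R]_n => v 0 j) by move=> a v w; rewrite !mxE.
have ud (t : R) : is_diff t u (fun s => 'd c t s 0 j).
  apply: (is_diff_linear cl (@coord_continuous _ _ _ 0 j)).
  by apply/differentiableP; have [+ _] := cs 1; apply.
have u'E t : u' t = 'd c t 1 0 j by rewrite /u' -ge derive1_graph_curve.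
have uu' t : derive1 u t = u' t.
  have d := ud t; rewrite derive1E' ?diff_val //; exact: ex_diff.
have u'c : continuous u'.
  move=> t; have -> : u' = fun t => (derive1 (f \o c) t).1 0 j.
    by apply/funext => s; rewrite ge.
  apply: (@continuous_comp _ _ _ (derive1 (f \o c)) (fun w => w.1 0 j)).
    exact: derive1_graph_curve_continuous.
  case: (derive1 _ t) => v a.
  apply: (@cvg_comp _ _ _ fst (fun v : 'rV[R]_n => v 0 j) _ (nbhs v)).
    exact: cvg_fst.
  exact: coord_continuous.
have uc : continuous u.
  by move=> t; have d := ud t; apply: differentiable_continuous; exact: ex_diff.
have FTC : u 1 - u 0 = \int[lebesgue_measure]_(t in `[0, 1]) u' t.
  rewrite /Rintegral (@continuous_FTC2 _ u' u) //.
  - exact: continuous_subspaceT.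
  - split=> [t _||].
    + by apply/derivable1_diffP; have d := ud t; exact: ex_diff.
    + by apply: cvg_at_right_filter; exact: uc.
    + by apply: cvg_at_left_filter; exact: uc.
rewrite -[X in `|X|]/(u 1 - u 0) FTC.
apply: le_trans (le_normr_Rintegral _ (continuous_integrable01 u'c)) _ => //.
rewrite /curve_length -RintegralZl //; last exact: (continuous_integrable01 speed_continuous).
apply: le_Rintegral => //.
- apply: (@continuous_integrable01 (fun t => `|u' t|)) => t.
  by apply: (@continuous_comp _ _ _ u' Num.norm); [exact: u'c|exact: norm_continuous].
- apply: (@continuous_integrable01 (fun t => Num.sqrt (g e e) * speed c t)) => t.
  by apply: cvgM; [exact: cvg_cst|exact: speed_continuous].
- by move=> t _; exact: cauchy_schwarz.
Qed.

Lemma curve_length_le (e : R) : (forall t, 0 <= t <= 1 -> speed c t <= e) ->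
  curve_length g f c <= e.
Proof.
move=> he; have i1 := continuous_integrable01 speed_continuous.
have i2 := @continuous_integrable01 (fun=> e) (@cst_continuous _ _ e).
have le t : `[0, 1]%classic t -> speed c t <= e by rewrite /= in_itv; exact: he.
apply: le_trans (le_Rintegral _ i1 i2 le) _ => //.
have m1 : @lebesgue_measure R `[0, 1] = 1%:E.
  by rewrite lebesgue_measure_itv /= lte_fin ltr01 oppr0 adde0.
by rewrite Rintegral_cst // (congr1 fine m1 : fine _ = 1) mulr1.
Qed.

End Curve.

Definition segment_curve (z x : 'rV[R]_n) (t : R) := z + t *: (x - z).

Lemma is_diff_segment_curve z x t : is_diff t (segment_curve z x) ( *:%R^~ (x - z)).
Proof.
have := is_diffD (is_diff_cst z t) (is_diff_scalel t (x - z)).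
by move/is_diff_eq; apply; rewrite add0r.
Qed.

Lemma smooth_segment_curve z x : smooth_on setT (segment_curve z x).
Proof.
move=> k; apply: (Ck_onD openT); first exact: Ck_on_cst.
apply: Ck_on_linear => [a b c|t]; first by rewrite scalerDl scalerA.
exact: scalel_continuous.
Qed.

Lemma speed_segment z x t : speed (segment_curve z x) t =
  Num.sqrt (g (x - z, 'd F (segment_curve z x t) (x - z))
              (x - z, 'd F (segment_curve z x t) (x - z))).
Proof.
rewrite /speed derive1_graph_curve; last exact: smooth_segment_curve.
by have d := is_diff_segment_curve z x t; rewrite diff_val scale1r.
Qed.

Lemma induced_distance_ge (e : 'rV[R]_n * R) (j : 'I_n) (x y : 'rV[R]_n) :
  (forall w, w.1 0 j = g e w) ->
  `|y 0 j - x 0 j| <= Num.sqrt (g e e) * induced_distance g f x y.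
Proof.
move=> ge.
have ne : [set curve_length g f c | c in
    [set c : R -> 'rV[R]_n | [/\ smooth_on setT c, c 0 = x & c 1 = y]]] !=set0.
  exists (curve_length g f (segment_curve x y)), (segment_curve x y) => //.
  split; [exact: smooth_segment_curve|by rewrite /segment_curve scale0r addr0|].
  by rewrite /segment_curve scale1r addrC subrK.
(* The bound passes to the infimum after division by the norm of [e]; if that norm is [0], a single
   curve suffices. *)
have [e0|epos] := eqVneq (Num.sqrt (g e e)) 0.
  case: ne => _ [c [cs c0 c1] _]; have := curve_length_ge cs ge.
  by rewrite c0 c1 e0 !mul0r.
have {}epos : 0 < Num.sqrt (g e e) by rewrite lt_neqAle eq_sym epos sqrtr_ge0.
rewrite -ler_pdivrMl //; apply: lb_le_inf => // _ [c [cs c0 c1] <-].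
by rewrite ler_pdivrMl // -c0 -c1; exact: curve_length_ge.
Qed.

Lemma induced_distance_ge0 x y : 0 <= induced_distance g f x y.
Proof.
apply: lb_le_inf; last by move=> _ [c [cs _ _] <-]; exact: curve_length_ge0.
exists (curve_length g f (segment_curve x y)), (segment_curve x y) => //.
split; [exact: smooth_segment_curve|by rewrite /segment_curve scale0r addr0|].
by rewrite /segment_curve scale1r addrC subrK.
Qed.

Lemma induced_distance_le x y : 
  induced_distance g f x y <= curve_length g f (segment_curve x y).
Proof.
apply: ge_inf; first by exists 0 => _ [c [cs _ _] <-]; exact: curve_length_ge0.
exists (segment_curve x y) => //; split; first exact: smooth_segment_curve.
  by rewrite /segment_curve scale0r addr0.
by rewrite /segment_curve scale1r addrC subrK.
Qed.

Lemma diff_graph_continuous : continuous (fun p : 'rV[R]_n * 'rV[R]_n => 'd F (p.1) p.2).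
Proof.
have -> : (fun p : 'rV[R]_n * 'rV[R]_n => 'd F (p.1) p.2) =
    fun p => \sum_j p.2 0 j *: 'd F (p.1) 'e_j.
  apply/funext => p; rewrite {1}(row_sum_delta p.2) linear_sum.
  by apply: eq_bigr => j _; rewrite linearZ.
apply: continuous_big_sum => j -[u v]; apply: cvgM => /=.
  by apply: (@cvg_comp _ _ _ snd (fun v : 'rV[R]_n => v 0 j) _ (nbhs v));
    [exact: cvg_snd|exact: coord_continuous].
apply: (@cvg_comp _ _ _ fst (fun u : 'rV[R]_n => 'd F u 'e_j) _ (nbhs u)).
  exact: cvg_fst.
by have [_ /(_ 'e_j) dc] := Fs 1; exact: dc.
Qed.

(** The lifted segment from [z] to [x] has speed [phi (point, x - z)], where [phi] is jointly
    continuous and vanishes at [(x, 0)]. *)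
Lemma induced_distance_small x (e : R) : 0 < e -> exists2 d : R, 0 < d &
  forall z, `|x - z| < d -> induced_distance g f z x <= e.
Proof.
move=> e0; pose phi (p : 'rV[R]_n * 'rV[R]_n) :=
  Num.sqrt (g (p.2, 'd F (p.1) p.2) (p.2, 'd F (p.1) p.2)).
have phic : continuous phi.
  move=> p; apply: (@continuous_comp _ _ _
    (fun p => g (p.2, 'd F (p.1) p.2) (p.2, 'd F (p.1) p.2)) Num.sqrt);
    last exact: sqrt_continuous.
  apply: (@continuous_comp _ _ _ (fun p => (p.2, 'd F (p.1) p.2)) (fun w => g w w));
    last exact: quadratic_continuous.
  by apply: continuous_pair; [exact: cvg_snd|exact: diff_graph_continuous].
have g00 : g 0 0 = 0.
  by case: gE => gb _ _; have := gb.1 0 (-1) 0 0; rewrite scaler0 addr0 /= => h; lra.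
have phi0 : phi (x, 0) = 0 by rewrite /phi /= linear0 g00 sqrtr0.
have /(_ (x, 0)) := phic; rewrite /continuous_at phi0 => /cvgrPdist_le /(_ e e0).
move=> /nbhs_ballP[d /= d0 dphi]; exists d => // z xz.
apply: le_trans (induced_distance_le z x) _.
apply: curve_length_le; first exact: smooth_segment_curve.
move=> t /andP[t0 t1]; rewrite speed_segment.
have := dphi (segment_curve z x t, x - z); rewrite sub0r normrN ger0_norm ?sqrtr_ge0 //; apply.
split => /=; rewrite -ball_normE /=; last by rewrite sub0r normrN.
apply: le_lt_trans xz; rewrite /segment_curve.
have -> : x - (z + t *: (x - z)) = (1 - t) *: (x - z).
  by rewrite opprD addrA scalerBl scale1r.
by rewrite normrZ ler_piMl // ger0_norm ?subr_ge0 // lerBlDr lerDl.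
Qed.

Lemma cauchy_induced_distance (s : nat -> 'rV[R]_n) :
  (forall e, 0 < e -> exists N, forall i j, (N <= i)%N -> (N <= j)%N ->
     induced_distance g f (s i) (s j) < e) -> cvgn s.
Proof.
move=> sc.
have [r rE] := choice (linear_form_representative gE).
(* The sum dominates every coordinate bound; the summand [1] keeps [K] positive. *)
pose K := 1 + \sum_j Num.sqrt (g (r j) (r j)).
have K1 : 1 <= K by rewrite lerDl; apply: sumr_ge0 => j _; exact: sqrtr_ge0.
have dK x y : `|x - y| <= K * induced_distance g f y x.
  rewrite [leLHS]mx_normrE; apply: bigmax_le => [|[i j] _].
    by rewrite mulr_ge0 // ?induced_distance_ge0 // (le_trans ler01).
  rewrite !mxE /= ord1; apply: le_trans (induced_distance_ge y x (rE j)) _.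
  apply: ler_wpM2r; first exact: induced_distance_ge0.
  by rewrite /K (bigD1 j) //= addrCA lerDl addr_ge0 // sumr_ge0.
apply: cauchy_cvg; apply: cauchy_exP => e e0.
have [N sN] := sc (e / K) (divr_gt0 e0 (lt_le_trans ltr01 K1)).
exists (s N); exists N => // i /= Ni; rewrite -ball_normE /=.
apply: le_lt_trans (dK _ _) _; rewrite mulrC -ltr_pdivlMr ?(lt_le_trans ltr01) //.
exact: sN.
Qed.

End Length.

Lemma euclidean_complete_graph : euclidean_complete f.
Proof.
move=> g gE s sc; have [x sx] := (cvg_ex _).1 (cauchy_induced_distance gE sc).
exists x; apply/cvgrPdist_lt => e e0.
have [d d0 dx] := induced_distance_small gE x (divr_gt0 e0 (ltr0Sn R 1)).
move/cvgrPdist_lt: sx => /(_ d d0); apply: filterS => i /dx ix.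
rewrite sub0r normrN ger0_norm; last exact: induced_distance_ge0.
by apply: le_lt_trans ix _; rewrite ltr_pdivrMr // ltr_pMr // ltr1n.
Qed.

End EuclideanCompleteness.

(** * The foliation by translates of a graph *)

Section GraphFoliation.
Context {R : realType}.

(** [G] is constant on balls inside [U]. As [A] is arbitrary, a level set and its complement are
    both open, which gives clopen subsets of leaves. *)
Lemma is_diff0_open (V : normedModType R) (U : set V) (G : V -> R) (A : set R) :
  open U -> (forall x, U x -> is_diff x G (fun=> 0)) -> open (U `&` G @^-1` A).
Proof.
move=> Uo Gd; rewrite openE => x [Ux Ax].
have /nbhs_ballP[r /= r0 rU] := open_nbhs_nbhs (conj Uo Ux).
apply/nbhs_ballP; exists r => // y; rewrite -ball_normE /= => xy.
have seg (t : R) : 0 <= t <= 1 -> U (x + t *: (y - x)).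
  move=> /andP[t0 t1]; apply: rU; rewrite -ball_normE /= opprD addrA subrr sub0r normrN.
  by rewrite normrZ (ger0_norm t0); apply: le_lt_trans xy; rewrite distrC ler_piMl.
have e : G y = G x by apply: is_diff0_segment => t /seg; exact: Gd.
split; last by rewrite /= e.
by have := seg 1; rewrite ler01 lexx scale1r addrC subrK; apply.
Qed.

Lemma connected_setT (V : normedModType R) : connected [set: V].
Proof.
pose S (y : V) := (fun t : R => t *: y) @` `[0, 1].
have -> : [set: V] = \bigcup_(y in setT) S y.
  apply/seteqP; split=> // y _; exists y => //; exists 1; last by rewrite scale1r.
  by rewrite /= in_itv /= ler01 lexx.
apply: bigcup_connected.
  by exists 0 => y _; exists 0; [rewrite /= in_itv /= lexx ler01|rewrite scale0r].
move=> y _; apply: connected_continuous_connected; first exact: segment_connected.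
by apply: continuous_subspaceT; exact: scalel_continuous.
Qed.

Context {n : nat}.
Variable F : 'rV[R]_n -> R.
Hypothesis Fs : smooth_on setT F.
Hypothesis F0 : F 0 = 0.
Local Notation f := (graph_map F).

Let Fd x : is_diff x F ('d F x).
Proof. by apply/differentiableP; have [+ _] := Fs 1; apply. Qed.

Let fd x : is_diff x f (fun u => (u, 'd F x u)).
Proof. exact: (is_diff_pair (is_diff_id x) (Fd x)). Qed.

Let df x u : 'd f x u = (u, 'd F x u).
Proof. by have d := fd x; rewrite diff_val. Qed.

Let fs : smooth_on setT f := smooth_graph_map Fs.

Definition graph_distribution (p : 'rV[R]_n * R) : set ('rV[R]_n * R) :=
  [set w | w.2 = 'd F (p.1) w.1].
Local Notation Delta := graph_distribution.

Definition graph_patched_set := PatchedSet (range f) [set (setT, f)].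
Local Notation M0 := graph_patched_set.

Lemma graph_regular_patch : regular_patch (setT, f).
Proof.
split=> /=; [exact: openT|exact: fs|by move=> x y _ _ []|].
by move=> x _ u v; rewrite !df => -[].
Qed.

Let fst_continuous : continuous (fun p : 'rV[R]_n * R => p.1).
Proof. by move=> p; exact: cvg_fst. Qed.

Let snd_continuous : continuous (fun p : 'rV[R]_n * R => p.2).
Proof. by move=> p; exact: cvg_snd. Qed.

Let fst_linear : linear (fun p : 'rV[R]_n * R => p.1). Proof. by []. Qed.
Let snd_linear : linear (fun p : 'rV[R]_n * R => p.2 : R). Proof. by []. Qed.

(** In the chart of the graph, a patch contained in it is its own first component. *)
Lemma smooth_transition_graph (P : @Defs.patch R n) : regular_patch P ->
  P.2 @` P.1 `<=` range f -> smooth_transition P (setT, f).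
Proof.
move=> [Po Ps _ _] Pf; rewrite /smooth_transition /=.
have -> : P.1 `&` P.2 @^-1` range f = P.1.
  by apply/seteqP; split=> [x []//|x Px]; split => //; apply: Pf; exists x.
split=> //; exists (fun x => (P.2 x).1).
  move=> k; exact: Ck_on_comp_linear Po fst_linear fst_continuous (Ps k).
move=> x [Px _]; split=> //.
by have [y _ <-] : range f (P.2 x) by apply: Pf; exists x.
Qed.

Lemma graph_integral_manifold : integral_manifold setT Delta M0.
Proof.
split=> //; last first.
  move=> _ x -> _ /=; apply/seteqP; split=> [_ [u _ <-]|[u a] /= ua].
    by rewrite df.
  by exists u => //; rewrite df; congr pair; exact: esym ua.
split=> [_ ->|_ _ -> ->|].
- by split; [exact: graph_regular_patch|].
- exact: smooth_transition_graph graph_regular_patch _.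
exists [set (setT, f)] => /=; first by split=> //; exact: countable1.
by rewrite bigcup_set1.
Qed.

Lemma graph_manifold_connected : manifold_connected M0.
Proof.
move=> O [OM /(_ (setT, f) erefl) /=]; rewrite setTI => Oo.
move=> [_ /(_ (setT, f) erefl) /=]; rewrite setTI => Oc.
have cE : f @^-1` (range f `\` O) = ~` (f @^-1` O).
  by apply/seteqP; split=> x /=; [case|split => //; exists x].
have [Oe|One] := pselect (f @^-1` O = set0).
  left; apply/seteqP; split=> // p Op; have [x _ xp] := OM _ Op.
  have : (f @^-1` O) x by rewrite /preimage /= xp.
  by rewrite Oe.
right; apply/seteqP; split=> // _ [x _ <-].
have -> : O (f x) = (f @^-1` O) x by [].
rewrite (connected_setT (B := f @^-1` O)) //.
- exact/set0P/eqP.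
- by exists (f @^-1` O); rewrite ?setTI.
- by exists (f @^-1` O); rewrite ?setTI // -[X in closed X]setCK -cE closedC.
Qed.

(* [alpha - F x] is locally constant on every integral manifold. *)
Lemma integral_manifold_graph N :
  connected_integral_manifold setT Delta (0, 0) N -> carrier N `<=` range f.
Proof.
move=> [[[Np _ _] _ Nt] Nc N0].
pose O := [set p | carrier N p /\ p.2 = F p.1].
pose G (P : @Defs.patch R n) t := (P.2 t).2 - F (P.2 t).1.
have Gd P : patches N P -> forall t, P.1 t -> is_diff t (G P : 'rV[R]_n -> R) (fun=> 0).
  move=> NP t Pt; have [[Po Ps _ _] _] := Np _ NP.
  have Pd : is_diff t P.2 ('d (P.2) t).
    by apply/differentiableP; have [+ _] := Ps 1; apply.
  have d1 := is_diff_linear fst_linear fst_continuous Pd.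
  have d2 := is_diff_linear snd_linear snd_continuous Pd.
  have := is_diffB d2 (is_diff_comp d1 (Fd (P.2 t).1)).
  move/is_diff_eq; apply; apply/funext => u.
  have : Delta (P.2 t) ('d (P.2) t u) by rewrite -(Nt P t NP Pt); exists u.
  by rewrite !fctE /= => ->; rewrite subrr.
have GE P A : patches N P -> open (P.1 `&` G P @^-1` A).
  move=> NP; apply: is_diff0_open; last exact: Gd.
  by have [[]] := Np _ NP.
have Oo : manifold_open N O.
  split=> [p []//|P NP]; have := GE P [set 0] NP; congr open.
  apply/seteqP; split=> t [Pt] /=.
    move=> /eqP; rewrite subr_eq0 => /eqP e; split=> //; split=> //.
    by have [_] := Np _ NP; apply; exists t.
  by move=> [_ e]; split=> //; rewrite /G e subrr.
have Oc : manifold_open N (carrier N `\` O).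
  split=> [p []//|P NP]; have := GE P [set~ 0] NP; congr open.
  apply/seteqP; split=> t [Pt] /= e; split=> //.
    split; first by have [_] := Np _ NP; apply; exists t.
    by move=> [_ e']; apply: e; rewrite /G e' subrr.
  move=> e'; case: e => cN; apply; split=> //.
  by apply/eqP; rewrite -subr_eq0; exact/eqP.
case: (Nc O Oo Oc) => [Oe|OE].
  have : O (0, 0) by split=> //=; rewrite F0.
  by rewrite Oe.
by rewrite -OE => -[x a] [_ /= ->]; exists x.
Qed.

Lemma integral_manifold_inclusion N :
  connected_integral_manifold setT Delta (0, 0) N -> smooth_inclusion N M0.
Proof.
move=> Nc; have Nf := integral_manifold_graph Nc; split=> // P Q NP ->.
have [[[Np _ _] _ _] _ _] := Nc; have [Pr Pc] := Np _ NP.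
by apply: smooth_transition_graph => //; exact: subset_trans Nf.
Qed.

Lemma graph_connected_integral : connected_integral_manifold setT Delta (0, 0) M0.
Proof.
split; [exact: graph_integral_manifold|exact: graph_manifold_connected|].
by exists 0 => //; rewrite /graph_map F0.
Qed.

Lemma graph_maximal_integral_manifold :
  maximal_integral_manifold setT Delta (0, 0) M0.
Proof.
by split; [exact: graph_connected_integral|exact: integral_manifold_inclusion].
Qed.

(** Maximality of [M], applied to the graph, and the inclusion of [M] in the graph give the
    transitions in the two directions. *)
Lemma maximal_global_parametrisation M :
  maximal_integral_manifold setT Delta (0, 0) M -> global_parametrisation M f.
Proof.
move=> [Mc Mmax]; have [cM tM] := Mmax _ graph_connected_integral.
split; first exact: graph_regular_patch.
  by apply/seteqP; split=> //; exact: integral_manifold_graph.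
move=> P MP; split; first exact: tM.
by have [_] := integral_manifold_inclusion Mc; apply.
Qed.

End GraphFoliation.

Import (canonicals) mpoly.

(** * Polynomiality of the potential *)

Section PolynomialFunctions.
Context {R : realType} {n : nat}.

Lemma polynomial_cst (a : R) : polynomial_function (fun _ : 'rV[R]_n => a).
Proof. by exists (mpoly.mpolyC n a) => x; rewrite mpoly.mevalC. Qed.

Lemma polynomial_coord (i : 'I_n) : polynomial_function (fun x : 'rV[R]_n => x 0 i).
Proof. by exists (mpoly.mpolyX R (mpoly.mnm1 i)) => x; rewrite mpoly.mevalXU. Qed.

Lemma polynomialD (F G : 'rV[R]_n -> R) : polynomial_function F ->
  polynomial_function G -> polynomial_function (fun x => F x + G x).
Proof. by move=> [p Fp] [q Gq]; exists (p + q) => x; rewrite mpoly.mevalD Fp Gq. Qed.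

Lemma polynomialM (F G : 'rV[R]_n -> R) : polynomial_function F ->
  polynomial_function G -> polynomial_function (fun x => F x * G x).
Proof. by move=> [p Fp] [q Gq]; exists (p * q) => x; rewrite mpoly.mevalM Fp Gq. Qed.

Lemma polynomial_sum (I : Type) (r : seq I) (F : I -> 'rV[R]_n -> R) :
  (forall i, polynomial_function (F i)) ->
  polynomial_function (fun x => \sum_(i <- r) F i x).
Proof.
move=> Fp; elim: r => [|i r IH].
  have -> : (fun x => \sum_(i <- [::]) F i x) = fun=> 0.
    by apply/funext => x; rewrite big_nil.
  exact: polynomial_cst.
have -> : (fun x => \sum_(i <- i :: r) F i x) = fun x => F i x + \sum_(i <- r) F i x.
  by apply/funext => x; rewrite big_cons.
exact: polynomialD.
Qed.

Lemma polynomial_potential (mul : {bilinear 'rV[R]_n -> 'rV[R]_n -> 'rV[R]_n})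
    (gamma : {bilinear 'rV[R]_n -> 'rV[R]_n -> R | *%R & *%R}) m :
  polynomial_function (potential mul gamma m).
Proof.
have powP k i : polynomial_function (fun x => pow mul x k 0 i).
  elim: k i => [|k IH] i; first exact: polynomial_coord.
  (* The product is expanded in the structure constants of the algebra. *)
  have -> : (fun x => pow mul x k.+1 0 i) = fun x =>
      \sum_a \sum_b x 0 a * (pow mul x k 0 b * mul 'e_a 'e_b 0 i).
    apply/funext => x; rewrite -[pow mul x k.+1]/(mul x (pow mul x k)).
    rewrite {1}(row_sum_delta x) linear_sumlz summxE; apply: eq_bigr => a _.
    rewrite linearZl mxE {1}(row_sum_delta (pow mul x k)) linear_sumr summxE mulr_sumr.
    by apply: eq_bigr => b _; rewrite linearZr mxE.
  apply: polynomial_sum => a; apply: polynomial_sum => b.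
  apply: polynomialM; first exact: polynomial_coord.
  by apply: polynomialM => //; exact: polynomial_cst.
apply: polynomial_sum => k; apply: polynomialM; first exact: polynomial_cst.
have -> : (fun x => gamma x (pow mul x k)) = fun x =>
    \sum_a \sum_b x 0 a * (pow mul x k 0 b * gamma 'e_a 'e_b).
  apply/funext => x; rewrite {1}(row_sum_delta x) linear_sumlz; apply: eq_bigr => a _.
  rewrite linearZl /= {1}(row_sum_delta (pow mul x k)) linear_sumr mulr_sumr.
  by apply: eq_bigr => b _; rewrite linearZr.
apply: polynomial_sum => a; apply: polynomial_sum => b.
apply: polynomialM; first exact: polynomial_coord.
by apply: polynomialM => //; exact: polynomial_cst.
Qed.

End PolynomialFunctions.

(** * The distribution of a metrised Jordan algebra *)

Section JordanFoliation.
Context {R : realType} {n : nat}.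
Variable mul : {bilinear 'rV[R]_n -> 'rV[R]_n -> 'rV[R]_n}.
Variable gamma : {bilinear 'rV[R]_n -> 'rV[R]_n -> R | *%R & *%R}.
Hypothesis mulC : forall x y, mul x y = mul y x.
Hypothesis jordan : forall x y, mul x (mul (mul x x) y) = mul (mul x x) (mul x y).
Variable m : nat.
Hypothesis mul_nil : forall x v, iter m (mul x) v = 0.
Hypothesis gammaC : forall u v, gamma u v = gamma v u.
Hypothesis gammaA : forall u v w, gamma (mul u v) w = gamma u (mul v w).

(** Nilpotency makes every element quasi-regular, and the whole space is connected. *)
Lemma jordan_DE : jordan_D mul = [set: 'rV[R]_n * R].
Proof.
apply/seteqP; split=> // -[x a] _; rewrite /jordan_D /jordan_Y /=.
apply: (@connected_component_max _ _ [set: 'rV[R]_n] 0) => //.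
  by move=> y _; exact: (quasi_regularT mulC jordan mul_nil).
exact: connected_setT.
Qed.

Lemma jordan_DeltaE : jordan_Delta mul gamma = graph_distribution (potential mul gamma m).
Proof.
apply/funext => -[x a]; apply/seteqP.
have d := is_diff_potential mulC jordan m gammaC gammaA x.
rewrite /jordan_Delta /graph_distribution /jordan_zeta /= (quasi_inverseE mulC jordan mul_nil).
split=> -[u b] /=; rewrite diff_val => /eqP; first by rewrite subr_eq0 => /eqP.
by move/eqP ->; rewrite subrr.
Qed.

(** Differentiating the tangency condition of one field along the other leaves a Hessian term
    [gamma u (H v)]; the two such terms in the bracket agree because the Hessian is symmetric. *)
Lemma involutive_graph_distribution D :
  involutive_distribution D (graph_distribution (potential mul gamma m)).
Proof.
move=> U X Y Uo _ Xs Ys XD YD p Up.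
pose F := potential mul gamma m.
have dF x u : 'd F x u = gamma u (quasi mul m x).
  by have d := is_diff_potential mulC jordan m gammaC gammaA x; rewrite diff_val.
have fstl : linear (fun p : 'rV[R]_n * R => p.1) by [].
have sndl : linear (fun p : 'rV[R]_n * R => p.2 : R) by [].
have fstc : continuous (fun p : 'rV[R]_n * R => p.1) by move=> q; exact: cvg_fst.
have sndc : continuous (fun p : 'rV[R]_n * R => p.2) by move=> q; exact: cvg_snd.
have dZ (Z : 'rV[R]_n * R -> 'rV[R]_n * R) : smooth_on U Z ->
    (forall p, U p -> graph_distribution F p (Z p)) -> forall w,
    ('d Z p w).2 = gamma ('d Z p w).1 (quasi mul m p.1)
      + gamma (Z p).1 (quasi_deriv mul m p.1 w.1).
  move=> Zs ZD w.
  have Zd : is_diff p Z ('d Z p) by apply/differentiableP; have [+ _] := Zs 1; apply.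
  have d1 := is_diff_linear fstl fstc Zd.
  have qd := is_diff_comp (is_diff_linear fstl fstc (is_diff_id p)) (is_diff_quasi mul_nil p.1).
  have gd := is_diff_bilinear (gamma_continuous_bilinear gamma) d1 qd.
  have d2 := is_diff_linear sndl sndc Zd.
  (* Tangency is known on [U] alone, so it is differentiated as an equality of germs. *)
  have near_eq : {near p, (fun q => gamma (Z q).1 (quasi mul m q.1)) =1 (fun q => (Z q).2)}.
    apply: filterS (open_nbhs_nbhs (conj Uo Up)) => q /ZD.
    by rewrite /graph_distribution /= dF.
  have := is_diff_unique (near_is_diff gd near_eq) d2.
  by move/(congr1 (fun l => l w)) => /= <-.
have key (A B : 'rV[R]_n * R) u v :
    A.2 = gamma A.1 (quasi mul m p.1) + gamma u (quasi_deriv mul m p.1 v) ->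
    B.2 = gamma B.1 (quasi mul m p.1) + gamma v (quasi_deriv mul m p.1 u) ->
    (A - B).2 = gamma (A - B).1 (quasi mul m p.1).
  move=> eA eB; transitivity (A.2 - B.2) => //.
  transitivity (gamma A.1 (quasi mul m p.1) - gamma B.1 (quasi mul m p.1)).
    have e : gamma u (quasi_deriv mul m p.1 v) = gamma v (quasi_deriv mul m p.1 u).
      by rewrite -(gamma_quasi_deriv mulC jordan mul_nil gammaA) gammaC.
    by rewrite eA eB e; ring.
  by apply/esym; exact: linearBl.
exact: etrans (key _ _ _ _ (dZ Y Ys YD (X p)) (dZ X Xs XD (Y p))) (esym (dF _ _)).
Qed.

End JordanFoliation.

Unset Implicit Arguments.

Theorem theorem4p16 (R : realType) (n : nat)
    (mul : 'rV[R]_n -> 'rV[R]_n -> 'rV[R]_n)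
    (gamma : 'rV[R]_n -> 'rV[R]_n -> R)
    (J_jordan : jordan_algebra mul)
    (J_nilpotent : nilpotent_algebra mul)
    (J_metrised : metrised_algebra mul gamma)
    (det_gamma : `| \det (form_matrix gamma) | = 1) :
  let D := jordan_D mul in
  let Delta := jordan_Delta mul gamma in
  let F := jordan_F mul gamma in
  let f := graph_map F in
  let xi := (0, 1) : 'rV[R]_n * R in
  [/\ involutive_distribution D Delta,
      exists M, maximal_integral_manifold D Delta (0, 0) M &
      forall M, maximal_integral_manifold D Delta (0, 0) M ->
        [/\ global_parametrisation M f, transversal_field f xi,
            (forall x, cvgn (fun N => \sum_(2 <= k < N)
                                       jordan_F_term mul gamma x k)),
            polynomial_function F &
            exists (nabla : 'rV[R]_n -> 'rV[R]_n -> 'rV[R]_n -> 'rV[R]_n)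
                   (h : 'rV[R]_n -> 'rV[R]_n -> 'rV[R]_n -> R)
                   (nabla_h : 'rV[R]_n -> 'rV[R]_n -> 'rV[R]_n -> 'rV[R]_n),
              [/\ induced_structure f xi nabla h, levi_civita h nabla_h &
                  [/\ non_degenerate h,
                      geodesically_complete nabla_h,
                      euclidean_complete f,
                      homogeneous f h &
                      [/\ symmetric_space h,
                          improper_affine_hypersphere f xi h &
                          parallel_cubic_form nabla h nabla_h]]]]].
Proof.
case: J_jordan => mul_bilinear mulC jordan.
case: J_nilpotent => -[//|m] _ mul_word.
case: J_metrised => -[gamma_bilinear gammaC gammaA] gamma_nd.
pose mulM := bilinear_isBilinear.Build _ _ _ _ _ _ mul mul_bilinear.
pose mulL : {bilinear 'rV[R]_n -> 'rV[R]_n -> 'rV[R]_n} := HB.pack mul mulM.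
pose gammaM := bilinear_isBilinear.Build _ _ _ _ _ _ gamma gamma_bilinear.
pose gammaL : {bilinear 'rV[R]_n -> 'rV[R]_n -> R | *%R & *%R} := HB.pack gamma gammaM.
have mul_nil x v : iter m.+1 (mulL x) v = 0.
  (* [iter m (mul x) v] is a word of [m.+1] letters, hence already zero. *)
  rewrite iterS (mul_word (iter m (mul x) v)); first exact: linear0r.
  exact: (@word_iter R n mulL m x v).
move=> D Delta F f xi.
have DE : D = setT by exact: (jordan_DE (mul := mulL) mulC jordan mul_nil).
have DeltaE : Delta = graph_distribution (potential mulL gammaL m.+1).
  exact: (jordan_DeltaE (mul := mulL) (gamma := gammaL) mulC jordan mul_nil gammaC gammaA).
have FE : F = potential mulL gammaL m.+1.
  exact: (jordan_FE (mul := mulL) gammaL mul_nil).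
have Fs := smooth_potential mulL gammaL m.+1.
have F0 : potential mulL gammaL m.+1 0 = 0.
  by apply: big1 => k _; rewrite linear0l mulr0.
rewrite /f DE DeltaE FE; split.
- exact: (involutive_graph_distribution (mul := mulL) (gamma := gammaL)
    mulC jordan mul_nil gammaC gammaA).
- exists (graph_patched_set (potential mulL gammaL m.+1)).
  exact: graph_maximal_integral_manifold.
move=> M MM; split.
- exact: maximal_global_parametrisation.
- exact: (transversal_graph (mul := mulL) (gamma := gammaL) mulC jordan gammaC gammaA).
- by move=> x; apply/cvg_ex; exists (potential mulL gammaL m.+1 x); exact: jordan_F_cvg.
- exact: polynomial_potential.
exists flat_connection, (affine_metric mulL gammaL m.+1), (christoffel mulL m.+1); split.
- exact: (induced_structure_graph (mul := mulL) (gamma := gammaL)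
    mulC jordan mul_nil gammaC gammaA).
- exact: (levi_civita_christoffel (mul := mulL) (gamma := gammaL)
    mulC jordan mul_nil gammaA).
split.
- exact: (non_degenerate_affine_metric (mul := mulL) (gamma := gammaL) mulC mul_nil gamma_nd).
- exact: (geodesically_complete_christoffel (mul := mulL) (gamma := gammaL)
    mulC jordan mul_nil gammaA).
- exact: euclidean_complete_graph.
- exact: (homogeneous_graph (mul := mulL) (gamma := gammaL)
    mulC jordan mul_nil gammaC gammaA).
split.
- exact: (symmetric_affine_metric (mul := mulL) (gamma := gammaL)
    mulC jordan mul_nil gammaC gammaA).
- exact: (improper_affine_hypersphere_graph (mul := mulL) (gamma := gammaL)
    mulC jordan mul_nil gammaC gammaA gamma_nd det_gamma).
- exact: (parallel_cubic_form_christoffel (mul := mulL) (gamma := gammaL)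
    mulC jordan mul_nil gammaC gammaA).
Qed.
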